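(* Let $r$ be a positive integer and $a>0$, and let $\mathbf{w}=\lambda(p_1,\ldots,p_r)$, where $\lambda>0$ is real, $p_1,\ldots,p_r$ are positive integers, and $\gcd(p_1,\ldots,p_r)=1$. Then the following two assertions are equivalent. (i) For every $\varepsilon>0$ and every real $\sigma$ with $r-\frac12\le\sigma\le r$, $$\zeta_r(\sigma+it,a,\mathbf{w})=O(t^{\varepsilon})\qquad (t\to\infty).$$ (ii) For every positive integer $k$, every $\varepsilon>0$ and every real $\sigma$ with $r-\frac12\le\sigma\le r$, $$\int_2^T\left|\zeta_r(\sigma+it,a,\mathbf{w})\right|^{2k}\,dt=O(T^{1+\varepsilon})\qquad (T\to\infty).$$ Here the implied constants may depend on $\varepsilon$, $k$, $\sigma$, $a$ and $\mathbf{w}$.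
   Context: For a positive integer $r$, a real number $a>0$, and $\mathbf{w}=(w_1,\ldots,w_r)$ with all $w_j>0$ real, the Barnes multiple zeta function is $$\zeta_r(s,a,\mathbf{w})=\sum_{m_1=0}^\infty\cdots\sum_{m_r=0}^\infty\frac{1}{(a+m_1w_1+\cdots+m_rw_r)^s},$$ where $s=\sigma+it$ is a complex variable with $\sigma,t$ real. The series converges absolutely for $\mathrm{Re}(s)>r$, and $\zeta_r(s,a,\mathbf{w})$ denotes also its meromorphic continuation to the whole complex $s$-plane, whose only possible poles are simple poles at $s=1,\ldots,r$. *)

(* Defs.v *)
From Stdlib Require Export Reals List.
From Coquelicot Require Export Coquelicot.
Open Scope R_scope.

(** [x ^ s = exp (s * ln x)] for real [x > 0] and complex [s], with the real
    logarithm of [x]; meaningful only for [0 < x], as for [Rpower]. *)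
Definition cpow (x : R) (s : C) : C :=
  (RtoC (Rpower x (Re s)) * (cos (Im s * ln x), sin (Im s * ln x)))%C.

(** The total operator [Series] applied to real and imaginary parts: the sum
    when the series converges, unspecified otherwise. *)
Definition CSeries (u : nat -> C) : C :=
  (Series (fun n => Re (u n)), Series (fun n => Im (u n))).

(** The number of variables is [length w], and the outermost sum belongs to
    the head of [w]: the innermost summand is reached with the first argument
    of [cpow] equal to [a + m_1 w_1 + ... + m_r w_r]. *)
Fixpoint barnes_series (s : C) (a : R) (w : list R) : C :=
  match w with
  | nil => (/ cpow a s)%C
  | wj :: w' => CSeries (fun m : nat => barnes_series s (a + INR m * wj) w')
  end.

Definition C_differentiable_at (f : C -> C) (s : C) : Prop :=
  ex_derive (K := C_AbsRing) (V := C_NormedModule) f s.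

(** Near [c], [f s = h s / (s - c)] with [h] holomorphic around [c]. The value
    of [f] at [c] itself is irrelevant. *)
Definition at_most_simple_pole (f : C -> C) (c : C) : Prop :=
  exists h : C -> C,
    locally c (fun s => C_differentiable_at h s /\
                        (s <> c -> f s = (h s / (s - c))%C)).

(** [Z] is [s |-> zeta_r (s, a, w)] with [r = length w]. The continuation is
    unique outside the points [1, ..., r], where the value of [Z] is left
    arbitrary. *)
Definition is_barnes_zeta (a : R) (w : list R) (Z : C -> C) : Prop :=
  let r := length w in
  (forall s : C, INR r < Re s -> Z s = barnes_series s a w) /\
  (forall s : C,
     (forall j : nat, (1 <= j <= r)%nat -> s <> RtoC (INR j)) ->
     C_differentiable_at Z s) /\
  (forall j : nat, (1 <= j <= r)%nat ->
     at_most_simple_pole Z (RtoC (INR j))).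

(** [f x = O (g x)] as [x] tends to infinity. *)
Definition big_O (f g : R -> R) : Prop :=
  exists K : R, Rbar_locally p_infty (fun x => Rabs (f x) <= K * Rabs (g x)).

Definition list_gcd (p : list nat) : nat := fold_right Nat.gcd 0%nat p.

(* Main.v *)
Require Import Defs.
From Stdlib Require Import Lra Lia Psatz.

(** (i) implies (ii) by raising the pointwise bound to the power [2k]. For the
    converse, a value of size [M] at height [tau] persists on an interval of
    length [tau^-n] as soon as zeta' grows polynomially on the vertical line,
    so that [tau^-n M^(2k)] is at most a fixed power of [tau]; let [k] grow.

    The growth of zeta' comes from a continuation to [Re s > r - 1]. With
    [k_v(s, x) = ((x+v)^(1-s) - x^(1-s)) / v - (1-s) x^(-s) = O(|s|^2 x^(-Re s-1))],
    summation over the lattice gives, for [w = (v, w')],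
    [(s - 1) zeta_r(s, a, w) = zeta_(r-1)(s - 1, a, w') / v + sum k_v(s, .)],
    where the last sum converges for [Re s > r - 1].

    The given continuation agrees with this one by an identity theorem, obtained
    from Goursat's theorem for rectangles and a concentrating Gaussian weight;
    only the upper half-plane, which contains no pole, is used. *)

(** * Complex differentiability *)

(** The hypotheses on the zeta function give its values for [Re s > r] and differentiability beyond,
    but nothing about its size; size can only come from an explicit formula. The degree of the
    polynomial bound may be arbitrary, because [k] is chosen after it. One correction kernel per
    variable is enough: the strip starts at [r - 1/2], inside [Re s > r - 1], and replacing [s] by
    [s - 1] while dropping a variable preserves the distance to the edge of the half-plane. The same
    unit of length makes the Gaussian argument work: the region where two continuations might differ
    is at most [1] wide, and a rectangle of half-height [2] then gives the factor [exp (n (1 - 4))]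
    on its horizontal sides. Of complex analysis only Goursat's theorem is established, so there is
    no Cauchy estimate to bound a derivative. Each derivative is therefore written down explicitly
    and bounded separately. For the lattice sums this rests on remainders of second order in the
    increment with explicit constants: such bounds can be summed over the lattice. *)

Definition Cderiv (f : C -> C) (z l : C) : Prop :=
  forall eps : R, 0 < eps -> exists delta : R, 0 < delta /\
    forall w : C, Cmod (w - z) < delta ->
      Cmod (f w - f z - l * (w - z)) <= eps * Cmod (w - z).

Lemma Cderiv_of_C_differentiable (f : C -> C) (z : C) :
  C_differentiable_at f z -> exists l : C, Cderiv f z l.
Proof.
  intros [l [_ Hl]]. exists l. intros eps Heps.
  destruct (Hl z (fun P H => H) (mkposreal eps Heps)) as [d Hd].
  exists d. split; [apply cond_pos |]. intros w Hw.
  rewrite (Cmult_comm l). exact (Hd w Hw).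
Qed.

(** The statement differentiates into [C_NormedModule], while the product rule needs
    [AbsRing_NormedModule C_AbsRing]. The explicit form [Cderiv] mediates between the two and lets
    the calculus rules be imported. *)
Lemma Cderiv_is_derive (f : C -> C) (z l : C) :
  Cderiv f z l <->
  is_derive (K := C_AbsRing) (V := AbsRing_NormedModule C_AbsRing) f z l.
Proof.
  split.
  - intros H. split; [apply is_linear_scal_l |].
    intros x Hx eps.
    apply (is_filter_lim_locally_unique (V := AbsRing_NormedModule C_AbsRing)) in Hx.
    subst x.
    destruct (H eps (cond_pos eps)) as [d [Hd H']].
    exists (mkposreal d Hd). intros w Hw.
    specialize (H' w Hw). rewrite (Cmult_comm l) in H'. exact H'.
  - intros [_ Hl] eps Heps.
    destruct (Hl z (fun P H => H) (mkposreal eps Heps)) as [d Hd].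
    exists d. split; [apply cond_pos |]. intros w Hw.
    rewrite (Cmult_comm l). exact (Hd w Hw).
Qed.

Lemma Cderiv_ext (f g : C -> C) (z l : C) :
  (forall w, f w = g w) -> Cderiv f z l -> Cderiv g z l.
Proof.
  intros E H eps He. destruct (H eps He) as [d [Hd H']].
  exists d. split; [exact Hd |]. intros w Hw. rewrite <- !E. auto.
Qed.

Lemma Cderiv_const (c z : C) : Cderiv (fun _ => c) z 0.
Proof. apply Cderiv_is_derive. exact (is_derive_const (K := C_AbsRing) (V := AbsRing_NormedModule C_AbsRing) c z). Qed.

Lemma Cderiv_id (z : C) : Cderiv (fun s => s) z 1.
Proof. apply Cderiv_is_derive. exact (is_derive_id (K := C_AbsRing) z). Qed.

Lemma Cderiv_plus (f g : C -> C) (z l m : C) :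
  Cderiv f z l -> Cderiv g z m -> Cderiv (fun s => f s + g s)%C z (l + m)%C.
Proof.
  intros Hf Hg. apply Cderiv_is_derive in Hf, Hg. apply Cderiv_is_derive.
  exact (is_derive_plus _ _ _ _ _ Hf Hg).
Qed.

Lemma Cderiv_minus (f g : C -> C) (z l m : C) :
  Cderiv f z l -> Cderiv g z m -> Cderiv (fun s => f s - g s)%C z (l - m)%C.
Proof.
  intros Hf Hg. apply Cderiv_is_derive in Hf, Hg. apply Cderiv_is_derive.
  exact (is_derive_minus _ _ _ _ _ Hf Hg).
Qed.

Lemma Cderiv_mult (f g : C -> C) (z l m : C) :
  Cderiv f z l -> Cderiv g z m ->
  Cderiv (fun s => f s * g s)%C z (l * g z + f z * m)%C.
Proof.
  intros Hf Hg. apply Cderiv_is_derive in Hf, Hg. apply Cderiv_is_derive.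
  exact (is_derive_mult _ _ _ _ _ Hf Hg Cmult_comm).
Qed.

Lemma Cderiv_comp (f g : C -> C) (z l m : C) :
  Cderiv f (g z) l -> Cderiv g z m -> Cderiv (fun s => f (g s)) z (m * l)%C.
Proof.
  intros Hf Hg. apply Cderiv_is_derive in Hf, Hg. apply Cderiv_is_derive.
  exact (is_derive_comp (V := AbsRing_NormedModule C_AbsRing) f g z l m Hf Hg).
Qed.

(** A second-order remainder with explicit [d] and [K] can be summed term by term, unlike an
    abstract eps-delta condition whose delta varies with the term. *)
Lemma Cderiv_of_quadratic (f : C -> C) (z l : C) (d K : R) :
  0 < d ->
  (forall h : C, Cmod h < d ->
     Cmod (f (z + h)%C - f z - l * h) <= K * Cmod h ^ 2) ->
  Cderiv f z l.
Proof.
  intros Hd H eps Heps.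
  set (K' := Rmax K 1).
  assert (HK : 0 < K') by (unfold K'; generalize (Rmax_r K 1); lra).
  exists (Rmin d (eps / K')). split.
  { apply Rmin_glb_lt; [exact Hd | now apply Rdiv_lt_0_compat]. }
  intros w Hw.
  assert (H1 : Cmod (w - z) < d) by (eapply Rlt_le_trans; [exact Hw | apply Rmin_l]).
  assert (H2 : Cmod (w - z) < eps / K') by (eapply Rlt_le_trans; [exact Hw | apply Rmin_r]).
  specialize (H _ H1). replace (z + (w - z))%C with w in H by ring.
  eapply Rle_trans; [exact H |].
  assert (H0 := Cmod_ge_0 (w - z)).
  assert (K * Cmod (w - z) ^ 2 <= K' * Cmod (w - z) ^ 2).
  { apply Rmult_le_compat_r; [apply pow2_ge_0 | apply Rmax_l]. }
  assert (Cmod (w - z) * K' <= eps).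
  { apply Rlt_le. apply (Rmult_lt_compat_r K') in H2; [| exact HK].
    unfold Rdiv in H2. rewrite Rmult_assoc, Rinv_l in H2; lra. }
  nra.
Qed.

(** * Moduli, and continuity along horizontal and vertical lines *)

Lemma im_le_Cmod (z : C) : Rabs (Im z) <= Cmod z.
Proof. eapply Rle_trans; [apply Rmax_r | apply Rmax_Cmod]. Qed.

Lemma Cmod_le_Re_Im (z : C) : Cmod z <= Rabs (Re z) + Rabs (Im z).
Proof.
  assert (H1 := Rabs_pos (Re z)). assert (H2 := Rabs_pos (Im z)).
  apply Rsqr_incr_0_var; [| lra].
  rewrite !Rsqr_pow2, Cmod2_alt, <- (pow2_abs (Re z)), <- (pow2_abs (Im z)).
  nra.
Qed.

Lemma Cmod_triangle_sub (x y : C) : Cmod (x - y) <= Cmod x + Cmod y.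
Proof. rewrite <- (Cmod_opp y). apply Cmod_triangle. Qed.

Lemma Cderiv_continuous (f : C -> C) (z l : C) :
  Cderiv f z l ->
  forall eps, 0 < eps -> exists delta, 0 < delta /\
    forall w, Cmod (w - z) < delta -> Cmod (f w - f z) < eps.
Proof.
  intros H eps Heps.
  destruct (H 1 Rlt_0_1) as [d [Hd H1]].
  assert (Hl := Cmod_ge_0 l).
  exists (Rmin d (eps / (2 + Cmod l))). split.
  { apply Rmin_glb_lt; [exact Hd | apply Rdiv_lt_0_compat; lra]. }
  intros w Hw.
  assert (Hw1 : Cmod (w - z) < d) by (eapply Rlt_le_trans; [exact Hw | apply Rmin_l]).
  assert (Hw2 : Cmod (w - z) < eps / (2 + Cmod l)) by (eapply Rlt_le_trans; [exact Hw | apply Rmin_r]).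
  specialize (H1 w Hw1).
  replace (f w - f z)%C with ((f w - f z - l * (w - z)) + l * (w - z))%C by ring.
  eapply Rle_lt_trans; [apply Cmod_triangle |]. rewrite Cmod_mult.
  assert (H0 := Cmod_ge_0 (w - z)).
  apply (Rmult_lt_compat_r (2 + Cmod l)) in Hw2; [| lra].
  unfold Rdiv in Hw2. rewrite Rmult_assoc, Rinv_l in Hw2 by lra. nra.
Qed.

Lemma Cmod_horizontal (x x' y : R) : Cmod ((x, y) - (x', y)) = Rabs (x - x').
Proof.
  rewrite <- Cmod_R. f_equal. apply injective_projections; simpl; ring.
Qed.

Lemma Cmod_vertical (x y y' : R) : Cmod ((x, y) - (x, y')) = Rabs (y - y').
Proof.
  replace ((x, y) - (x, y'))%C with (Ci * (y - y'))%C
    by (apply injective_projections; simpl; ring).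
  rewrite Cmod_mult, Cmod_Ci, <- RtoC_minus, Cmod_R. ring.
Qed.

Lemma continuous_of_eps (f : R -> R) (x : R) :
  (forall eps, 0 < eps -> exists delta, 0 < delta /\
     forall y, Rabs (y - x) < delta -> Rabs (f y - f x) < eps) ->
  continuous f x.
Proof.
  intros H P [e He]. destruct (H e (cond_pos e)) as [d [Hd H']].
  exists (mkposreal d Hd). intros y Hy. apply He. now apply H'.
Qed.

Lemma continuous_horizontal (f : C -> C) (x y : R) :
  (exists l, Cderiv f (x, y) l) ->
  continuous (fun t => Re (f (t, y))) x /\ continuous (fun t => Im (f (t, y))) x.
Proof.
  intros [l Hl].
  split; apply continuous_of_eps; intros eps Heps;
    destruct (Cderiv_continuous _ _ _ Hl eps Heps) as [d [Hd H]];
    exists d; (split; [exact Hd |]); intros t Ht;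
    (assert (Ht' : Cmod ((t, y) - (x, y)) < d) by now rewrite Cmod_horizontal);
    specialize (H _ Ht'); eapply Rle_lt_trans; [| exact H | | exact H].
  - apply (re_le_Cmod (f (t, y) - f (x, y))%C).
  - apply (im_le_Cmod (f (t, y) - f (x, y))%C).
Qed.

Lemma continuous_vertical (f : C -> C) (x y : R) :
  (exists l, Cderiv f (x, y) l) ->
  continuous (fun t => Re (f (x, t))) y /\ continuous (fun t => Im (f (x, t))) y.
Proof.
  intros [l Hl].
  split; apply continuous_of_eps; intros eps Heps;
    destruct (Cderiv_continuous _ _ _ Hl eps Heps) as [d [Hd H]];
    exists d; (split; [exact Hd |]); intros t Ht;
    (assert (Ht' : Cmod ((x, t) - (x, y)) < d) by now rewrite Cmod_vertical);
    specialize (H _ Ht'); eapply Rle_lt_trans; [| exact H | | exact H].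
  - apply (re_le_Cmod (f (x, t) - f (x, y))%C).
  - apply (im_le_Cmod (f (x, t) - f (x, y))%C).
Qed.

(** Used with the value of the affine part in Goursat's theorem, and with [k = 0] as the plain bound
    of an integral by length times supremum. *)
Lemma RInt_near_const (f : R -> R) (a b k e : R) :
  a <= b -> (forall t, a <= t <= b -> continuous f t) ->
  (forall t, a <= t <= b -> Rabs (f t - k) <= e) ->
  Rabs (RInt f a b - k * (b - a)) <= e * (b - a).
Proof.
  intros Hab Hc Hb.
  assert (Hf : ex_RInt f a b).
  { apply (ex_RInt_continuous (V := R_CompleteNormedModule)). intros t.
    rewrite Rmin_left, Rmax_right by exact Hab. apply Hc. }
  assert (H : RInt (fun t => f t - k) a b = RInt f a b - k * (b - a)).
  { rewrite (RInt_minus (V := R_CompleteNormedModule) f (fun _ => k));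
      [| exact Hf | apply ex_RInt_const].
    rewrite RInt_const. unfold minus, plus, opp, scal; simpl; unfold mult; simpl. ring. }
  rewrite <- H.
  eapply Rle_trans.
  - apply abs_RInt_le_const with (M := e); try assumption.
    apply (ex_RInt_minus (V := R_NormedModule) f (fun _ => k));
      [exact Hf | apply ex_RInt_const].
  - lra.
Qed.

(** * Goursat's theorem *)

(** The real part of the integral of [f] around the boundary of
    [[x, x + h] x [y, y + k]]. *)
Definition rect_int (f : C -> C) (x y h k : R) : R :=
  RInt (fun t => Re (f (t, y)) - Re (f (t, y + k))) x (x + h)
  - RInt (fun t => Im (f (x + h, t)) - Im (f (x, t))) y (y + k).

Definition rect_diff (f : C -> C) (x y h k : R) : Prop :=
  forall u v, x <= u <= x + h -> y <= v <= y + k -> exists l, Cderiv f (u, v) l.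

Lemma ex_RInt_horizontal (f : C -> C) (x h y y' : R) :
  0 <= h -> (forall u, x <= u <= x + h ->
    (exists l, Cderiv f (u, y) l) /\ (exists l, Cderiv f (u, y') l)) ->
  ex_RInt (fun t => Re (f (t, y)) - Re (f (t, y'))) x (x + h).
Proof.
  intros Hh H. apply (ex_RInt_continuous (V := R_CompleteNormedModule)). intros t.
  rewrite Rmin_left, Rmax_right by lra. intros Ht.
  destruct (H t Ht) as [H1 H2].
  apply (continuous_minus (V := R_NormedModule)).
  - exact (proj1 (continuous_horizontal f t y H1)).
  - exact (proj1 (continuous_horizontal f t y' H2)).
Qed.

Lemma ex_RInt_vertical (f : C -> C) (x x' y k : R) :
  0 <= k -> (forall v, y <= v <= y + k ->
    (exists l, Cderiv f (x, v) l) /\ (exists l, Cderiv f (x', v) l)) ->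
  ex_RInt (fun t => Im (f (x', t)) - Im (f (x, t))) y (y + k).
Proof.
  intros Hh H. apply (ex_RInt_continuous (V := R_CompleteNormedModule)). intros t.
  rewrite Rmin_left, Rmax_right by lra. intros Ht.
  destruct (H t Ht) as [H1 H2].
  apply (continuous_minus (V := R_NormedModule)).
  - exact (proj2 (continuous_vertical f x' t H2)).
  - exact (proj2 (continuous_vertical f x t H1)).
Qed.

Lemma rect_int_split_x (f : C -> C) (x y h1 h2 k : R) :
  0 <= h1 -> 0 <= h2 -> 0 <= k -> rect_diff f x y (h1 + h2) k ->
  rect_int f x y (h1 + h2) k = rect_int f x y h1 k + rect_int f (x + h1) y h2 k.
Proof.
  intros H1 H2 Hk H. unfold rect_int.
  rewrite <- !Rplus_assoc.
  rewrite <- (RInt_Chasles (V := R_CompleteNormedModule) _ x (x + h1) (x + h1 + h2)).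
  - assert (E : RInt (fun t => Im (f (x + h1 + h2, t)) - Im (f (x, t))) y (y + k)
            = RInt (fun t => Im (f (x + h1, t)) - Im (f (x, t))) y (y + k)
            + RInt (fun t => Im (f (x + h1 + h2, t)) - Im (f (x + h1, t))) y (y + k)).
    { rewrite <- (RInt_plus (V := R_CompleteNormedModule)).
      - apply RInt_ext. intros t _. unfold plus; simpl. ring.
      - apply ex_RInt_vertical; [exact Hk |]. intros v Hv. split; apply H; lra.
      - apply ex_RInt_vertical; [exact Hk |]. intros v Hv. split; apply H; lra. }
    rewrite E. unfold plus; simpl. ring.
  - apply ex_RInt_horizontal; [lra |]. intros u Hu. split; apply H; lra.
  - apply ex_RInt_horizontal; [lra |]. intros u Hu. split; apply H; lra.
Qed.

Lemma rect_int_split_y (f : C -> C) (x y h k1 k2 : R) :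
  0 <= h -> 0 <= k1 -> 0 <= k2 -> rect_diff f x y h (k1 + k2) ->
  rect_int f x y h (k1 + k2) = rect_int f x y h k1 + rect_int f x (y + k1) h k2.
Proof.
  intros Hh H1 H2 H. unfold rect_int.
  rewrite <- !Rplus_assoc.
  rewrite <- (RInt_Chasles (V := R_CompleteNormedModule) _ y (y + k1) (y + k1 + k2)).
  - assert (E : RInt (fun t => Re (f (t, y)) - Re (f (t, y + k1 + k2))) x (x + h)
            = RInt (fun t => Re (f (t, y)) - Re (f (t, y + k1))) x (x + h)
            + RInt (fun t => Re (f (t, y + k1)) - Re (f (t, y + k1 + k2))) x (x + h)).
    { rewrite <- (RInt_plus (V := R_CompleteNormedModule)).
      - apply RInt_ext. intros t _. unfold plus; simpl. ring.
      - apply ex_RInt_horizontal; [exact Hh |]. intros v Hv. split; apply H; lra.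
      - apply ex_RInt_horizontal; [exact Hh |]. intros v Hv. split; apply H; lra. }
    rewrite E. unfold plus; simpl. ring.
  - apply ex_RInt_vertical; [lra |]. intros u Hu. split; apply H; lra.
  - apply ex_RInt_vertical; [lra |]. intros u Hu. split; apply H; lra.
Qed.

(** The affine approximation of [f] at [c] integrates to [0]. *)
Lemma rect_int_affine_bound (f : C -> C) (c l : C) (x y h k eps delta : R) :
  0 <= h -> 0 <= k -> 0 <= eps -> rect_diff f x y h k ->
  x <= Re c <= x + h -> y <= Im c <= y + k -> h + k < delta ->
  (forall w, Cmod (w - c) < delta ->
     Cmod (f w - f c - l * (w - c)) <= eps * Cmod (w - c)) ->
  Rabs (rect_int f x y h k) <= 2 * eps * (h + k) ^ 2.
Proof.
  intros Hh Hk He Hd Hx Hy Hdel Hf.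
  assert (Hp : forall u v, x <= u <= x + h -> y <= v <= y + k ->
            Cmod (f (u, v) - f c - l * ((u, v) - c)) <= eps * (h + k)).
  { intros u v Hu Hv.
    assert (Hw : Cmod ((u, v) - c) <= h + k).
    { eapply Rle_trans; [apply Cmod_le_Re_Im |]. simpl.
      apply Rplus_le_compat; apply Rabs_le; unfold Re, Im in *; lra. }
    eapply Rle_trans; [apply Hf; lra |].
    now apply Rmult_le_compat_l. }
  (* On opposite sides the affine part differs by the constants [Im l * k] and [Im l * h]. Both
     integrate to [Im l * h * k], which cancels in [rect_int]; only the errors at the two sides
     remain, hence the factor 2. *)
  assert (H1 : Rabs (RInt (fun t => Re (f (t, y)) - Re (f (t, y + k))) x (x + h)
             - (Im l * k) * (x + h - x)) <= (2 * eps * (h + k)) * (x + h - x)).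
  { apply RInt_near_const; [lra | |].
    - intros t Ht. apply (continuous_minus (V := R_NormedModule));
        refine (proj1 (continuous_horizontal f t _ _)); apply Hd; lra.
    - intros t Ht.
      assert (A1 := Hp t y Ht ltac:(lra)). assert (A2 := Hp t (y + k) Ht ltac:(lra)).
      assert (B1 := Rle_trans _ _ _ (re_le_Cmod _) A1).
      assert (B2 := Rle_trans _ _ _ (re_le_Cmod _) A2).
      destruct l as [l1 l2]. destruct c as [c1 c2].
      destruct (f (t, y)) as [p1 p2]. destruct (f (t, y + k)) as [q1 q2].
      destruct (f (c1, c2)) as [r1 r2]. simpl in *.
      apply Rabs_le_between in B1. apply Rabs_le_between in B2. apply Rabs_le. nra. }
  assert (H2 : Rabs (RInt (fun t => Im (f (x + h, t)) - Im (f (x, t))) y (y + k)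
             - (Im l * h) * (y + k - y)) <= (2 * eps * (h + k)) * (y + k - y)).
  { apply RInt_near_const; [lra | |].
    - intros t Ht. apply (continuous_minus (V := R_NormedModule));
        refine (proj2 (continuous_vertical f _ t _)); apply Hd; lra.
    - intros t Ht.
      assert (A1 := Hp x t ltac:(lra) Ht). assert (A2 := Hp (x + h) t ltac:(lra) Ht).
      assert (B1 := Rle_trans _ _ _ (im_le_Cmod _) A1).
      assert (B2 := Rle_trans _ _ _ (im_le_Cmod _) A2).
      destruct l as [l1 l2]. destruct c as [c1 c2].
      destruct (f (x, t)) as [p1 p2]. destruct (f (x + h, t)) as [q1 q2].
      destruct (f (c1, c2)) as [r1 r2]. simpl in *.
      apply Rabs_le_between in B1. apply Rabs_le_between in B2. apply Rabs_le. nra. }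
  unfold rect_int.
  apply Rabs_le_between in H1. apply Rabs_le_between in H2. apply Rabs_le. nra.
Qed.

Lemma nested_intervals (u d : nat -> R) :
  (forall n, 0 <= d n) -> (forall n, u n <= u (S n)) ->
  (forall n, u (S n) + d (S n) <= u n + d n) ->
  exists c, forall n, u n <= c <= u n + d n.
Proof.
  intros Hd Hu Hv.
  assert (Hmono : forall n m, u n <= u (m + n)%nat /\ u (m + n)%nat + d (m + n)%nat <= u n + d n).
  { intros n m. induction m as [| m IH]; simpl; [lra |].
    generalize (Hu (m + n)%nat) (Hv (m + n)%nat). lra. }
  assert (Hle : forall n m, u n <= u m + d m).
  { intros n m. destruct (Nat.le_ge_cases n m) as [H | H].
    - generalize (proj1 (Hmono n (m - n)%nat)) (Hd m).
      replace (m - n + n)%nat with m by lia. lra.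
    - generalize (proj2 (Hmono m (n - m)%nat)) (Hd n).
      replace (n - m + m)%nat with n by lia. lra. }
  destruct (completeness (fun v => exists n, v = u n)) as [c [Hc1 Hc2]].
  - exists (u 0%nat + d 0%nat). intros v [n ->]. apply Hle.
  - now exists (u 0%nat), 0%nat.
  - exists c. intros n. split.
    + apply Hc1. now exists n.
    + apply Hc2. intros v [m ->]. apply Hle.
Qed.

(** The first half is kept if it carries at least half of the integral; otherwise additivity forces
    the second half to do so. Deciding by [Rle_dec] makes the sequence of rectangles a genuine
    function. *)
Definition half_x (f : C -> C) (x y h k : R) : R :=
  if Rle_dec (Rabs (rect_int f x y h k)) (2 * Rabs (rect_int f x y (h / 2) k))
  then x else x + h / 2.

Definition half_y (f : C -> C) (x y h k : R) : R :=
  if Rle_dec (Rabs (rect_int f x y h k)) (2 * Rabs (rect_int f x y h (k / 2)))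
  then y else y + k / 2.

Lemma half_x_spec (f : C -> C) (x y h k : R) :
  0 <= h -> 0 <= k -> rect_diff f x y h k ->
  x <= half_x f x y h k <= x + h / 2 /\
  Rabs (rect_int f x y h k) <= 2 * Rabs (rect_int f (half_x f x y h k) y (h / 2) k).
Proof.
  intros Hh Hk H. unfold half_x.
  destruct Rle_dec as [Hle | Hgt]; [split; [lra | exact Hle] |].
  split; [lra |].
  assert (E := rect_int_split_x f x y (h / 2) (h / 2) k).
  replace (h / 2 + h / 2) with h in E by field.
  specialize (E ltac:(lra) ltac:(lra) Hk H).
  generalize (Rabs_triang (rect_int f x y (h / 2) k) (rect_int f (x + h / 2) y (h / 2) k)).
  rewrite <- E. lra.
Qed.

Lemma half_y_spec (f : C -> C) (x y h k : R) :
  0 <= h -> 0 <= k -> rect_diff f x y h k ->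
  y <= half_y f x y h k <= y + k / 2 /\
  Rabs (rect_int f x y h k) <= 2 * Rabs (rect_int f x (half_y f x y h k) h (k / 2)).
Proof.
  intros Hh Hk H. unfold half_y.
  destruct Rle_dec as [Hle | Hgt]; [split; [lra | exact Hle] |].
  split; [lra |].
  assert (E := rect_int_split_y f x y h (k / 2) (k / 2)).
  replace (k / 2 + k / 2) with k in E by field.
  specialize (E Hh ltac:(lra) ltac:(lra) H).
  generalize (Rabs_triang (rect_int f x y h (k / 2)) (rect_int f x (y + k / 2) h (k / 2))).
  rewrite <- E. lra.
Qed.

(** Only the lower left corner is stored, since the sides at stage [n] are [h / 2 ^ n] and
    [k / 2 ^ n]. A stage bisects in [x] and then in [y], so the integral loses at most a factor
    4. *)
Fixpoint quarter (f : C -> C) (x y h k : R) (n : nat) : R * R :=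
  match n with
  | O => (x, y)
  | S m =>
      let q := quarter f x y h k m in
      let u := half_x f (fst q) (snd q) (h / 2 ^ m) (k / 2 ^ m) in
      (u, half_y f u (snd q) (h / 2 ^ m / 2) (k / 2 ^ m))
  end.

Lemma quarter_step (f : C -> C) (x y h k : R) (n : nat) :
  let q := quarter f x y h k n in
  let q' := quarter f x y h k (S n) in
  0 <= h -> 0 <= k -> rect_diff f (fst q) (snd q) (h / 2 ^ n) (k / 2 ^ n) ->
  fst q <= fst q' /\ fst q' + h / 2 ^ S n <= fst q + h / 2 ^ n /\
  snd q <= snd q' /\ snd q' + k / 2 ^ S n <= snd q + k / 2 ^ n /\
  Rabs (rect_int f (fst q) (snd q) (h / 2 ^ n) (k / 2 ^ n)) <=
  4 * Rabs (rect_int f (fst q') (snd q') (h / 2 ^ S n) (k / 2 ^ S n)).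
Proof.
  intros q q' Hh Hk H.
  assert (Hp : 0 < 2 ^ n) by (apply pow_lt; lra).
  assert (Hh' : 0 <= h / 2 ^ n) by (apply Rdiv_le_0_compat; assumption).
  assert (Hk' : 0 <= k / 2 ^ n) by (apply Rdiv_le_0_compat; assumption).
  replace (h / 2 ^ S n) with (h / 2 ^ n / 2) by (simpl; field; lra).
  replace (k / 2 ^ S n) with (k / 2 ^ n / 2) by (simpl; field; lra).
  unfold q'. simpl. fold q.
  destruct (half_x_spec f (fst q) (snd q) _ _ Hh' Hk' H) as [H1 H2].
  set (u := half_x f (fst q) (snd q) (h / 2 ^ n) (k / 2 ^ n)) in *.
  destruct (half_y_spec f u (snd q) (h / 2 ^ n / 2) (k / 2 ^ n)) as [H3 H4];
    [lra | exact Hk' | |].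
  { intros a b Ha Hb. apply H; lra. }
  repeat split; lra.
Qed.

Lemma rect_int_eq_0 (f : C -> C) (x y h k : R) :
  0 <= h -> 0 <= k -> rect_diff f x y h k -> rect_int f x y h k = 0.
Proof.
  intros Hh Hk H.
  set (q := quarter f x y h k).
  assert (Hp : forall n, 0 < 2 ^ n) by (intros n; apply pow_lt; lra).
  assert (Hh' : forall n, 0 <= h / 2 ^ n) by (intros n; now apply Rdiv_le_0_compat).
  assert (Hk' : forall n, 0 <= k / 2 ^ n) by (intros n; now apply Rdiv_le_0_compat).
  assert (Hin : forall n, x <= fst (q n) /\ fst (q n) + h / 2 ^ n <= x + h /\
                 y <= snd (q n) /\ snd (q n) + k / 2 ^ n <= y + k).
  { intros n. induction n as [| n IH]; [simpl; lra |].
    destruct (quarter_step f x y h k n Hh Hk) as (H1 & H2 & H3 & H4 & _).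
    - intros u v Hu Hv. fold (q n) in Hu, Hv. apply H; lra.
    - fold (q n) (q (S n)) in H1, H2, H3, H4. lra. }
  assert (Hst : forall n, rect_diff f (fst (q n)) (snd (q n)) (h / 2 ^ n) (k / 2 ^ n)).
  { intros n u v Hu Hv. specialize (Hin n). apply H; lra. }
  assert (Hs := fun n => quarter_step f x y h k n Hh Hk (Hst n)).
  assert (HI : forall n, Rabs (rect_int f x y h k) <=
     4 ^ n * Rabs (rect_int f (fst (q n)) (snd (q n)) (h / 2 ^ n) (k / 2 ^ n))).
  { intros n. induction n as [| n IH].
    - simpl. rewrite !Rdiv_1_r. lra.
    - destruct (Hs n) as (_ & _ & _ & _ & H5). fold (q n) (q (S n)) in H5.
      apply (Rmult_le_compat_l (4 ^ n)) in H5; [| apply pow_le; lra].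
      replace (4 ^ S n) with (4 ^ n * 4) by (simpl; ring). lra. }
  destruct (nested_intervals (fun n => fst (q n)) (fun n => h / 2 ^ n)) as [cx Hcx].
  { exact Hh'. } { intros n. apply (Hs n). } { intros n. apply (Hs n). }
  destruct (nested_intervals (fun n => snd (q n)) (fun n => k / 2 ^ n)) as [cy Hcy].
  { exact Hk'. } { intros n. apply (Hs n). } { intros n. apply (Hs n). }
  destruct (H cx cy) as [l Hl].
  { specialize (Hcx 0%nat). simpl in Hcx. lra. }
  { specialize (Hcy 0%nat). simpl in Hcy. lra. }
  (* The loss [4 ^ N] is exactly compensated by the square of the sides in the affine bound, which
     is [4 ^ N] times smaller than [(h + k) ^ 2]. *)
  assert (Hsmall : forall eps, 0 < eps -> Rabs (rect_int f x y h k) <= 2 * eps * (h + k) ^ 2).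
  { intros eps Heps. destruct (Hl eps Heps) as [delta [Hdelta Hf]].
    destruct (pow_lt_1_zero (/ 2)) with (y := delta / (h + k + 1)) as [N HN].
    { rewrite Rabs_pos_eq; lra. }
    { apply Rdiv_lt_0_compat; lra. }
    specialize (HN N (le_n N)). rewrite Rabs_pos_eq in HN by (apply pow_le; lra).
    rewrite pow_inv in HN.
    assert (HN2 : h / 2 ^ N + k / 2 ^ N < delta).
    { apply (Rmult_lt_compat_r (h + k + 1)) in HN; [| lra].
      unfold Rdiv at 1 in HN. rewrite Rmult_assoc, Rinv_l in HN by lra.
      assert (0 < / 2 ^ N) by (apply Rinv_0_lt_compat; apply Hp).
      unfold Rdiv. lra. }
    eapply Rle_trans; [apply (HI N) |].
    assert (B := rect_int_affine_bound f (cx, cy) l (fst (q N)) (snd (q N)) (h / 2 ^ N) (k / 2 ^ N)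
                   eps delta (Hh' N) (Hk' N) (Rlt_le _ _ Heps) (Hst N) (Hcx N) (Hcy N) HN2 Hf).
    apply (Rmult_le_compat_l (4 ^ N)) in B; [| apply pow_le; lra].
    eapply Rle_trans; [exact B |]. apply Req_le.
    replace (4 ^ N) with (2 ^ N * 2 ^ N)
      by (rewrite <- Rpow_mult_distr; f_equal; ring).
    generalize (Hp N). intros. field. lra. }
  destruct (Req_dec (rect_int f x y h k) 0) as [E | E]; [exact E | exfalso].
  apply Rabs_pos_lt in E.
  set (A := Rabs (rect_int f x y h k)) in *.
  (* This divisor makes the bound at most [A / 2]; the summand 1 covers the degenerate rectangle
     with [h + k = 0]. *)
  assert (HB : 0 < 4 * ((h + k) ^ 2 + 1)) by (generalize (pow2_ge_0 (h + k)); lra).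
  specialize (Hsmall (A / (4 * ((h + k) ^ 2 + 1))) (Rdiv_lt_0_compat _ _ E HB)).
  assert (A / (4 * ((h + k) ^ 2 + 1)) * (4 * ((h + k) ^ 2 + 1)) = A) by (field; lra).
  assert (0 < A / (4 * ((h + k) ^ 2 + 1))) by (now apply Rdiv_lt_0_compat).
  nra.
Qed.

(** * The complex exponential *)

Definition cexp (z : C) : C := (exp (Re z) * cos (Im z), exp (Re z) * sin (Im z)).

Lemma cexp_plus (z w : C) : cexp (z + w) = (cexp z * cexp w)%C.
Proof.
  destruct z as [a b], w as [c d]. unfold cexp, Cmult; simpl.
  rewrite exp_plus, cos_plus, sin_plus. apply injective_projections; simpl; ring.
Qed.

Lemma cexp_0 : cexp 0 = 1.
Proof.
  unfold cexp; simpl. rewrite exp_0, cos_0, sin_0.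
  apply injective_projections; simpl; ring.
Qed.

Lemma Cmod_cexp (z : C) : Cmod (cexp z) = exp (Re z).
Proof.
  unfold Cmod, cexp; simpl.
  transitivity (sqrt (Rsqr (exp (Re z)))).
  - f_equal. transitivity (Rsqr (exp (Re z)) * (Rsqr (sin (Im z)) + Rsqr (cos (Im z)))).
    + unfold Rsqr. ring.
    + rewrite sin2_cos2. ring.
  - apply sqrt_Rsqr. left. apply exp_pos.
Qed.

Lemma cexp_nz (z : C) : cexp z <> 0.
Proof. apply Cmod_gt_0. rewrite Cmod_cexp. apply exp_pos. Qed.

Lemma cexp_opp (z : C) : cexp (- z) = (/ cexp z)%C.
Proof.
  assert (E : (cexp z * cexp (- z) = 1)%C).
  { rewrite <- cexp_plus. replace (z + - z)%C with (RtoC 0) by ring. apply cexp_0. }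
  rewrite <- (Cmult_1_l (cexp (- z))), <- (Cinv_l (cexp z)) by apply cexp_nz.
  rewrite <- Cmult_assoc, E. ring.
Qed.

Lemma cpow_cexp (x : R) (s : C) : cpow x s = cexp (RtoC (ln x) * s)%C.
Proof.
  unfold cpow, cexp, Rpower. destruct s as [a b].
  apply injective_projections; simpl;
    rewrite ?Rmult_0_l, ?Rminus_0_r, ?Rplus_0_r, (Rmult_comm a), (Rmult_comm b); ring.
Qed.

(** * Complex-valued functions of a real variable *)

Definition RCderiv (f : R -> C) (t : R) (d : C) : Prop :=
  is_derive (fun u => Re (f u)) t (Re d) /\ is_derive (fun u => Im (f u)) t (Im d).

Lemma RCderiv_plus (f g : R -> C) (t : R) (d e : C) :
  RCderiv f t d -> RCderiv g t e -> RCderiv (fun u => f u + g u)%C t (d + e)%C.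
Proof.
  intros [H1 H2] [H3 H4]. split.
  - exact (is_derive_plus _ _ _ _ _ H1 H3).
  - exact (is_derive_plus _ _ _ _ _ H2 H4).
Qed.

Lemma RCderiv_scal (c : C) (f : R -> C) (t : R) (d : C) :
  RCderiv f t d -> RCderiv (fun u => c * f u)%C t (c * d)%C.
Proof.
  intros [H1 H2]. destruct c as [a b]. split.
  - apply (is_derive_minus (V := R_NormedModule) (fun u => a * Re (f u)) (fun u => b * Im (f u)));
      now apply is_derive_scal.
  - apply (is_derive_plus (V := R_NormedModule) (fun u => a * Im (f u)) (fun u => b * Re (f u)));
      now apply is_derive_scal.
Qed.

Lemma RCderiv_const (c : C) (t : R) : RCderiv (fun _ => c) t 0.
Proof. split; apply (is_derive_const (V := R_NormedModule)). Qed.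

Lemma RCderiv_ext (f g : R -> C) (t : R) (d e : C) :
  (forall u, f u = g u) -> d = e -> RCderiv f t d -> RCderiv g t e.
Proof.
  intros E <- [H1 H2]. split; (eapply is_derive_ext; [| eassumption]);
    intros u; simpl; now rewrite E.
Qed.

Lemma RCderiv_RtoC (f : R -> R) (t d : R) :
  is_derive f t d -> RCderiv (fun u => RtoC (f u)) t (RtoC d).
Proof. intros H. split; [exact H | exact (is_derive_const (V := R_NormedModule) 0 t)]. Qed.

Lemma RCderiv_mult (f g : R -> C) (t : R) (d e : C) :
  RCderiv f t d -> RCderiv g t e ->
  RCderiv (fun u => f u * g u)%C t (d * g t + f t * e)%C.
Proof.
  intros [H1 H2] [H3 H4]. split.
  - eapply is_derive_ext; [intros u; symmetry; apply re_mult |].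
    replace (Re (d * g t + f t * e)%C) with
      ((Re d * Re (g t) + Re (f t) * Re e) - (Im d * Im (g t) + Im (f t) * Im e))
      by (rewrite re_plus, !re_mult; ring).
    apply (is_derive_minus (V := R_NormedModule)
             (fun u => Re (f u) * Re (g u)) (fun u => Im (f u) * Im (g u)));
      apply (is_derive_mult (K := R_AbsRing)); auto; exact Rmult_comm.
  - eapply is_derive_ext; [intros u; symmetry; apply im_mult |].
    replace (Im (d * g t + f t * e)%C) with
      ((Re d * Im (g t) + Re (f t) * Im e) + (Im d * Re (g t) + Im (f t) * Re e))
      by (rewrite im_plus, !im_mult; ring).
    apply (is_derive_plus (V := R_NormedModule)
             (fun u => Re (f u) * Im (g u)) (fun u => Im (f u) * Re (g u)));
      apply (is_derive_mult (K := R_AbsRing)); auto; exact Rmult_comm.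
Qed.

Lemma RCderiv_cexp (g : R -> R) (z : C) (t d : R) :
  is_derive g t d ->
  RCderiv (fun u => cexp (RtoC (g u) * z)%C) t (RtoC d * z * cexp (RtoC (g t) * z))%C.
Proof.
  intros H. destruct z as [a b].
  assert (Hd : Derive g t = d) by now apply is_derive_unique.
  assert (He : ex_derive g t) by now exists d.
  split; simpl; auto_derive; try (repeat split; exact He || exact I);
    change (Derive (fun x => g x) t) with (Derive g t); rewrite Hd; simpl;
    rewrite !Rmult_0_l, Ropp_0, !Rminus_0_r, !Rplus_0_r; ring.
Qed.

(** The factor [2] comes from treating real and imaginary parts separately. *)
Lemma RC_mean_value (f df : R -> C) (a b D : R) :
  a <= b ->
  (forall t, a <= t <= b -> RCderiv f t (df t) /\ Cmod (df t) <= D) ->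
  Cmod (f b - f a) <= 2 * D * (b - a).
Proof.
  intros Hab H.
  assert (Hg : forall (g dg : R -> R),
    (forall t, a <= t <= b -> is_derive g t (dg t) /\ Rabs (dg t) <= D) ->
    Rabs (g b - g a) <= D * (b - a)).
  { intros g dg Hg. destruct (MVT_gen g a b dg) as [c [Hc E]].
    - rewrite Rmin_left, Rmax_right by exact Hab. intros t Ht. apply Hg. lra.
    - rewrite Rmin_left, Rmax_right by exact Hab. intros t Ht.
      apply continuity_pt_filterlim.
      apply (ex_derive_continuous (K := R_AbsRing) (V := R_NormedModule)).
      exists (dg t). now apply Hg.
    - rewrite Rmin_left, Rmax_right in Hc by exact Hab.
      rewrite E, Rabs_mult, (Rabs_pos_eq (b - a)) by lra.
      apply Rmult_le_compat_r; [lra | now apply Hg]. }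
  eapply Rle_trans; [apply Cmod_le_Re_Im |].
  replace (2 * D * (b - a)) with (D * (b - a) + D * (b - a)) by ring.
  apply Rplus_le_compat.
  - apply (Hg (fun u => Re (f u)) (fun u => Re (df u))). intros t Ht.
    destruct (H t Ht) as [[H1 _] H2]. split; [exact H1 |].
    eapply Rle_trans; [apply re_le_Cmod | exact H2].
  - apply (Hg (fun u => Im (f u)) (fun u => Im (df u))). intros t Ht.
    destruct (H t Ht) as [[_ H1] H2]. split; [exact H1 |].
    eapply Rle_trans; [apply im_le_Cmod | exact H2].
Qed.

Lemma Cmod_cexp_scal_le (u : R) (z : C) :
  0 <= u <= 1 -> Cmod (cexp (RtoC u * z)) <= exp (Cmod z).
Proof.
  intros Hu. rewrite Cmod_cexp, re_scal_l.
  assert (H := re_le_Cmod z). apply Rabs_le_between in H.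
  assert (H0 := Cmod_ge_0 z).
  destruct (Rle_lt_or_eq_dec (u * Re z) (Cmod z)) as [Hl | ->]; [nra | | lra].
  left. now apply exp_increasing.
Qed.

Lemma cexp_sub_1_bound (z : C) : Cmod (cexp z - 1) <= 2 * (Cmod z * exp (Cmod z)).
Proof.
  assert (H := RC_mean_value (fun u => cexp (RtoC u * z))
                 (fun u => RtoC 1 * z * cexp (RtoC u * z))%C 0 1 (Cmod z * exp (Cmod z)) Rle_0_1).
  simpl in H. rewrite Cmult_1_l, Cmult_0_l, cexp_0 in H.
  rewrite Rminus_0_r, Rmult_1_r in H. apply H.
  intros t Ht. split.
  - eapply RCderiv_ext; [reflexivity | | apply (RCderiv_cexp (fun u => u) z t 1)].
    + simpl. ring.
    + apply (is_derive_id (K := R_AbsRing)).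
  - rewrite Cmod_mult. apply Rmult_le_compat_l; [apply Cmod_ge_0 |].
    now apply Cmod_cexp_scal_le.
Qed.

(** The function [cexp (u z) - u z] of [u] in [[0, 1]] has derivative [z (cexp (u z) - 1)], to which
    the first-order bound applies. Each of the two mean value steps contributes a factor 2. *)
Lemma cexp_taylor_bound (z : C) :
  Cmod (cexp z - 1 - z) <= 4 * (Cmod z ^ 2 * exp (Cmod z)).
Proof.
  assert (H := RC_mean_value (fun u => cexp (RtoC u * z) + - z * RtoC u)%C
                 (fun u => RtoC 1 * z * cexp (RtoC u * z) + - z * RtoC 1)%C 0 1
                 (2 * (Cmod z ^ 2 * exp (Cmod z))) Rle_0_1).
  simpl in H. rewrite Cmult_1_l, Cmult_0_l, cexp_0 in H.
  replace (cexp z - 1 - z)%C with (cexp z + - z * 1 - (1 + - z * 0))%C by ring.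
  eapply Rle_trans; [apply H | apply Req_le; simpl; ring].
  intros t Ht. split.
  - apply RCderiv_plus.
    + eapply RCderiv_ext; [reflexivity | | apply (RCderiv_cexp (fun u => u) z t 1)].
      * simpl. ring.
      * apply (is_derive_id (K := R_AbsRing)).
    + apply RCderiv_scal, (RCderiv_RtoC (fun u => u)). apply (is_derive_id (K := R_AbsRing)).
  - replace (z * cexp (t * z) + - z * 1)%C with (z * (cexp (RtoC t * z) - 1))%C by ring.
    rewrite Cmod_mult.
    assert (B := cexp_sub_1_bound (RtoC t * z)%C).
    assert (Ht' : Cmod (RtoC t * z) <= Cmod z).
    { rewrite Cmod_mult, Cmod_R, Rabs_pos_eq by lra.
      assert (H0 := Cmod_ge_0 z). nra. }
    assert (He : exp (Cmod (RtoC t * z)) <= exp (Cmod z)).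
    { destruct Ht' as [Ht' | ->]; [left; now apply exp_increasing | lra]. }
    assert (H0 := Cmod_ge_0 z). assert (H1 := Cmod_ge_0 (RtoC t * z)%C).
    assert (H2 := exp_pos (Cmod (RtoC t * z))).
    assert (Cmod (RtoC t * z) * exp (Cmod (RtoC t * z)) <= Cmod z * exp (Cmod z))
      by (apply Rmult_le_compat; lra).
    replace (Cmod z * (Cmod z * 1)) with (Cmod z * Cmod z) by ring. nra.
Qed.

Lemma Cderiv_cexp (z : C) : Cderiv cexp z (cexp z).
Proof.
  apply (Cderiv_of_quadratic _ _ _ 1 (4 * (exp 1 * exp (Re z)))); [lra |].
  intros h Hh. rewrite cexp_plus.
  replace (cexp z * cexp h - cexp z - cexp z * h)%C with (cexp z * (cexp h - 1 - h))%C by ring.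
  rewrite Cmod_mult, Cmod_cexp.
  assert (H := cexp_taylor_bound h).
  assert (He : exp (Cmod h) <= exp 1) by (left; now apply exp_increasing).
  assert (H0 := exp_pos (Re z)). assert (H1 := pow2_ge_0 (Cmod h)).
  assert (Cmod h ^ 2 * exp (Cmod h) <= Cmod h ^ 2 * exp 1) by now apply Rmult_le_compat_l.
  replace (4 * (exp 1 * exp (Re z)) * Cmod h ^ 2) with (exp (Re z) * (4 * (Cmod h ^ 2 * exp 1))) by ring.
  apply Rmult_le_compat_l; lra.
Qed.

(** * Continuous functions on segments *)

Lemma bounded_on_segment (f : R -> R) (a b : R) :
  a <= b -> (forall t, a <= t <= b -> continuous f t) ->
  exists M, 0 <= M /\ forall t, a <= t <= b -> Rabs (f t) <= M.
Proof.
  intros Hab Hc.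
  destruct (continuity_ab_maj (fun t => Rabs (f t)) a b Hab) as [m [Hm Hm']].
  - intros t Ht. apply continuity_pt_filterlim.
    apply (continuous_comp f Rabs); [now apply Hc | apply continuous_Rabs].
  - exists (Rabs (f m)). split; [apply Rabs_pos | exact Hm].
Qed.

Lemma RInt_subinterval_le (f : R -> R) (a a' b' b : R) :
  a <= a' -> a' <= b' -> b' <= b ->
  (forall t, a <= t <= b -> continuous f t) ->
  (forall t, a <= t <= b -> 0 <= f t) ->
  RInt f a' b' <= RInt f a b.
Proof.
  intros H1 H2 H3 Hc Hp.
  assert (Hi : forall u v, a <= u -> u <= v -> v <= b -> ex_RInt f u v).
  { intros u v Hu Huv Hv. apply (ex_RInt_continuous (V := R_CompleteNormedModule)).
    rewrite Rmin_left, Rmax_right by exact Huv. intros t Ht. apply Hc. lra. }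
  rewrite <- (RInt_Chasles (V := R_CompleteNormedModule) f a a' b) by (apply Hi; lra).
  rewrite <- (RInt_Chasles (V := R_CompleteNormedModule) f a' b' b) by (apply Hi; lra).
  assert (0 <= RInt f a a').
  { apply RInt_ge_0; [lra | apply Hi; lra |]. intros t Ht. apply Hp. lra. }
  assert (0 <= RInt f b' b).
  { apply RInt_ge_0; [lra | apply Hi; lra |]. intros t Ht. apply Hp. lra. }
  unfold plus; simpl. lra.
Qed.

(** * An identity theorem *)

(** The square of [1 + x / 2 <= exp (x / 2)]. Quadratic growth is what is needed to beat the
    normalisation [1 / n] of the Gaussian. *)
Lemma exp_ge_sqr (x : R) : 0 <= x -> x ^ 2 / 4 <= exp x.
Proof.
  intros Hx. replace x with (x / 2 + x / 2) at 2 by field. rewrite exp_plus.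
  assert (1 + x / 2 <= exp (x / 2)).
  { destruct (Req_dec x 0) as [-> | H].
    - replace (0 / 2) with 0 by field. rewrite exp_0. lra.
    - left. apply exp_ineq1. lra. }
  nra.
Qed.

Lemma exp_le_exp (x y : R) : x <= y -> exp x <= exp y.
Proof. intros [H | ->]; [left; now apply exp_increasing | lra]. Qed.

Lemma gaussian_continuous (n t y : R) : continuous (fun v => exp (- n * (v - t) ^ 2)) y.
Proof.
  apply (ex_derive_continuous (K := R_AbsRing) (V := R_NormedModule)).
  auto_derive. exact I.
Qed.

(** On [|v - t| <= 1 / n] the exponent is at least [- 1 / n], hence at least [- 1]. The true order
    is the inverse square root of [n], but [1 / n] is good enough against an exponentially small
    right-hand side. *)
Lemma gaussian_integral_lower (n t H : R) :
  1 <= n -> 1 <= H ->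
  2 / n * exp (- 1) <= RInt (fun v => exp (- n * (v - t) ^ 2)) (t - H) (t + H).
Proof.
  intros Hn HH.
  assert (Hn1 : 0 < / n) by (apply Rinv_0_lt_compat; lra).
  assert (Hn2 : / n <= 1) by (rewrite <- Rinv_1; apply Rinv_le_contravar; lra).
  eapply Rle_trans;
    [| apply (RInt_subinterval_le _ (t - H) (t - / n) (t + / n) (t + H)); try lra].
  - replace (2 / n * exp (- 1)) with (RInt (fun _ => exp (- 1)) (t - / n) (t + / n)).
    + apply RInt_le; [lra | apply ex_RInt_const | |].
      * apply (ex_RInt_continuous (V := R_CompleteNormedModule)).
        intros y _. apply gaussian_continuous.
      * intros y Hy. apply exp_le_exp.
        assert ((y - t) ^ 2 <= / n ^ 2).
        { rewrite <- pow_inv. apply pow_maj_Rabs. apply Rabs_le. lra. }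
        assert (n * / n ^ 2 <= 1) by (replace (n * / n ^ 2) with (/ n) by (field; lra); lra).
        nra.
    + rewrite RInt_const. unfold scal; simpl; unfold mult; simpl. field. lra.
  - intros y _. apply gaussian_continuous.
  - intros y _. left. apply exp_pos.
Qed.

Lemma Cmod_bounded_horizontal (f : C -> C) (a b y : R) :
  a <= b -> (forall t, a <= t <= b -> exists l, Cderiv f (t, y) l) ->
  exists M, 0 <= M /\ forall t, a <= t <= b -> Cmod (f (t, y)) <= M.
Proof.
  intros Hab H.
  destruct (bounded_on_segment (fun t => Re (f (t, y))) a b Hab) as [M1 [H1 H1']].
  { intros t Ht. exact (proj1 (continuous_horizontal f t y (H t Ht))). }
  destruct (bounded_on_segment (fun t => Im (f (t, y))) a b Hab) as [M2 [H2 H2']].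
  { intros t Ht. exact (proj2 (continuous_horizontal f t y (H t Ht))). }
  exists (M1 + M2). split; [lra |]. intros t Ht.
  eapply Rle_trans; [apply Cmod_le_Re_Im |].
  specialize (H1' t Ht). specialize (H2' t Ht). lra.
Qed.

Lemma Cmod_bounded_vertical (f : C -> C) (a b x : R) :
  a <= b -> (forall t, a <= t <= b -> exists l, Cderiv f (x, t) l) ->
  exists M, 0 <= M /\ forall t, a <= t <= b -> Cmod (f (x, t)) <= M.
Proof.
  intros Hab H.
  destruct (bounded_on_segment (fun t => Re (f (x, t))) a b Hab) as [M1 [H1 H1']].
  { intros t Ht. exact (proj1 (continuous_vertical f x t (H t Ht))). }
  destruct (bounded_on_segment (fun t => Im (f (x, t))) a b Hab) as [M2 [H2 H2']].
  { intros t Ht. exact (proj2 (continuous_vertical f x t (H t Ht))). }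
  exists (M1 + M2). split; [lra |]. intros t Ht.
  eapply Rle_trans; [apply Cmod_le_Re_Im |].
  specialize (H1' t Ht). specialize (H2' t Ht). lra.
Qed.

Lemma Cderiv_gaussian (n : R) (w z : C) :
  exists l, Cderiv (fun s => cexp (RtoC n * ((s - w) * (s - w)))) z l.
Proof.
  assert (H1 : Cderiv (fun s => s - w)%C z (1 - 0)%C)
    by (apply Cderiv_minus; [apply Cderiv_id | apply Cderiv_const]).
  eexists. apply Cderiv_comp with (g := fun s => (RtoC n * ((s - w) * (s - w)))%C).
  - apply Cderiv_cexp.
  - apply Cderiv_mult; [apply Cderiv_const |]. apply Cderiv_mult; exact H1.
Qed.

Lemma Cmod_gaussian (n : R) (w : C) (x y : R) :
  Cmod (cexp (RtoC n * (((x, y) - w) * ((x, y) - w)))) =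
  exp (n * ((x - Re w) ^ 2 - (y - Im w) ^ 2)).
Proof.
  rewrite Cmod_cexp. f_equal. destruct w as [a b]. simpl. ring.
Qed.

(** The Gaussian [exp (n (z - w)^2)] is at least [1] only in the horizontal
    double cone at [w]; Goursat's theorem on a rectangle with left side
    through [w] and right side in the zero set of [f] shows that the Gaussian
    average of [f] on the left side, which tends to [f w], is exponentially
    small compared with its normalisation [1 / n]. *)
Lemma vanishing_continuation (f : C -> C) (c b sigma t : R) :
  (forall s, c < Re s -> 0 < Im s -> exists l, Cderiv f s l) ->
  (forall s, b < Re s -> 0 < Im s -> f s = 0) ->
  c < sigma -> b - 1 <= sigma -> 2 < t -> f (sigma, t) = 0.
Proof.
  intros Hf Hz Hc Hb Ht.
  destruct (Rlt_le_dec b sigma) as [Hbs | Hbs]; [apply Hz; simpl; lra |].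
  destruct (Ceq_dec (f (sigma, t)) 0) as [E | E]; [exact E | exfalso].
  set (w := (sigma, t) : C).
  (* Normalising to [phi w = 1] makes the real part of [phi] at least [1 / 2] near [w], so that the
     Gaussian average of [Re phi] alone gives the contradiction. *)
  set (phi := fun s => (/ f w * f s)%C).
  assert (Hphi : forall s, c < Re s -> 0 < Im s -> exists l, Cderiv phi s l).
  { intros s Hs1 Hs2. destruct (Hf s Hs1 Hs2) as [l Hl].
    eexists. apply Cderiv_mult; [apply Cderiv_const | exact Hl]. }
  assert (Hphi0 : forall s, b < Re s -> 0 < Im s -> phi s = 0).
  { intros s Hs1 Hs2. unfold phi. rewrite (Hz s) by assumption. ring. }
  assert (Hphiw : phi w = 1) by (unfold phi; now apply Cinv_l).
  clearbody phi. clear Hf Hz E f.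
  (* The right side lies at abscissa [b + 1], inside the zero set. The heights [t - 2] and [t + 2]
     stay in the upper half-plane because [2 < t]. *)
  set (h := b + 1 - sigma). assert (Hh : 1 <= h <= 2) by (unfold h; lra).
  destruct (Cmod_bounded_horizontal phi sigma (sigma + h) (t - 2)) as [M1 [HM1 HM1']];
    [lra | intros u Hu; apply Hphi; simpl; lra |].
  destruct (Cmod_bounded_horizontal phi sigma (sigma + h) (t + 2)) as [M2 [HM2 HM2']];
    [lra | intros u Hu; apply Hphi; simpl; lra |].
  destruct (Cmod_bounded_vertical phi (t - 2) (t + 2) sigma) as [M3 [HM3 HM3']];
    [lra | intros u Hu; apply Hphi; simpl; lra |].
  destruct (Hphi w) as [lw Hlw]; [simpl; lra | simpl; lra |].
  destruct (Cderiv_continuous _ _ _ Hlw (1 / 2)) as [d0 [Hd0 Hd0']]; [lra |].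
  set (d := Rmin d0 1).
  assert (Hd : 0 < d) by (apply Rmin_glb_lt; lra).
  assert (Hd1 : d <= 1) by apply Rmin_r.
  assert (Hre : forall y, Rabs (y - t) < d -> 1 / 2 <= Re (phi (sigma, y))).
  { intros y Hy. assert (Hy' : Cmod ((sigma, y) - w) < d0).
    { unfold w. rewrite Cmod_vertical. eapply Rlt_le_trans; [exact Hy | apply Rmin_l]. }
    specialize (Hd0' _ Hy'). rewrite Hphiw in Hd0'.
    assert (B := re_le_Cmod (phi (sigma, y) - 1)%C).
    apply Rabs_le_between in B. simpl in B. unfold Re in *. lra. }
  (* The factor 2 bounds the width of the rectangle and 4 is its height. *)
  set (A := 2 * (M1 + M2) + 4 * (M3 + 1)).
  assert (HA : 4 <= A) by (unfold A; lra).
  assert (Hmain : forall n, 1 <= n -> / n * exp (- 1) <= A * exp (- n * d ^ 2)).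
  { intros n Hn.
    set (G := fun s => cexp (RtoC n * ((s - w) * (s - w)))).
    (* On vertical sides [rect_int] sees only [Im g]. The factor [Ci] turns it into the real part of
       [phi * G], which is the Gaussian average of [Re phi] on the line through [w]. *)
    set (g := fun s => (Ci * (phi s * G s))%C).
    assert (Hg : rect_diff g sigma (t - 2) h 4).
    { intros u v Hu Hv. destruct (Hphi (u, v)) as [l Hl]; [simpl; lra | simpl; lra |].
      destruct (Cderiv_gaussian n w (u, v)) as [m Hm].
      eexists. apply Cderiv_mult; [apply Cderiv_const |].
      apply Cderiv_mult; [exact Hl | exact Hm]. }
    assert (HI := rect_int_eq_0 g sigma (t - 2) h 4 ltac:(lra) ltac:(lra) Hg).
    unfold rect_int in HI.
    replace (t - 2 + 4) with (t + 2) in HI by ring.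
    (* Either [x > b] and [phi] vanishes, or [x - sigma <= b - sigma <= 1] and the exponent is at
       most [n (1 - 4)]. *)
    assert (HG : forall x y M, sigma <= x -> 0 < y -> 0 <= M -> (y - t) ^ 2 = 4 -> Cmod (phi (x, y)) <= M ->
              Rabs (Re (g (x, y))) <= M * exp (- 3 * n)).
    { intros x y M Hx Hy HM Hyt HMy. eapply Rle_trans; [apply re_le_Cmod |].
      unfold g, G. rewrite !Cmod_mult, Cmod_Ci, Cmod_gaussian, Rmult_1_l.
      destruct (Rlt_le_dec b x) as [Hbx | Hbx].
      - rewrite Hphi0 by assumption. rewrite Cmod_0, Rmult_0_l.
        apply Rmult_le_pos; [exact HM | left; apply exp_pos].
      - apply Rmult_le_compat; [apply Cmod_ge_0 | left; apply exp_pos | exact HMy |].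
        apply exp_le_exp. unfold w; simpl Re; simpl Im. rewrite Hyt.
        assert ((x - sigma) ^ 2 <= 1) by nra. nra. }
    assert (H1 : Rabs (RInt (fun u => Re (g (u, t - 2)) - Re (g (u, t + 2))) sigma (sigma + h)
               - 0 * (sigma + h - sigma)) <= ((M1 + M2) * exp (- 3 * n)) * (sigma + h - sigma)).
    { apply RInt_near_const; [lra | |].
      - intros u Hu. apply (continuous_minus (V := R_NormedModule));
          refine (proj1 (continuous_horizontal g u _ _)); apply Hg; lra.
      - intros u Hu.
        assert (B1 := HG u (t - 2) M1 ltac:(lra) ltac:(lra) HM1 ltac:(ring) (HM1' u Hu)).
        assert (B2 := HG u (t + 2) M2 ltac:(lra) ltac:(lra) HM2 ltac:(ring) (HM2' u Hu)).
        apply Rabs_le_between in B1. apply Rabs_le_between in B2. apply Rabs_le. lra. }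
    assert (Hv : forall y, Im (g (sigma, y)) = Re (phi (sigma, y)) * exp (- n * (y - t) ^ 2)).
    { intros y. unfold g, G, w.
      replace (RtoC n * (((sigma, y) - (sigma, t)) * ((sigma, y) - (sigma, t))))%C
        with (RtoC (- n * (y - t) ^ 2))
        by (apply injective_projections; simpl; ring).
      unfold cexp. simpl. rewrite cos_0, sin_0. unfold Re. ring. }
    assert (H2 : RInt (fun v => Im (g (sigma + h, v)) - Im (g (sigma, v))) (t - 2) (t + 2)
               = - RInt (fun v => Re (phi (sigma, v)) * exp (- n * (v - t) ^ 2)) (t - 2) (t + 2)).
    { rewrite <- (RInt_opp (V := R_CompleteNormedModule)).
      - apply RInt_ext. rewrite Rmin_left, Rmax_right by lra. intros v Hv'.
        rewrite Hv. unfold g. rewrite Hphi0 by (simpl; unfold h; lra).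
        unfold opp; simpl. ring.
      - apply (ex_RInt_continuous (V := R_CompleteNormedModule)).
        rewrite Rmin_left, Rmax_right by lra. intros v Hv'.
        apply (continuous_mult (K := R_AbsRing)); [| apply gaussian_continuous].
        refine (proj1 (continuous_vertical phi sigma v _)). apply Hphi; simpl; lra. }
    rewrite H2 in HI.
    (* Within distance [d] of [t] the real part is at least [1 / 2]. Farther away it is at least
       [- M3] and the Gaussian is at most [exp (- n * d ^ 2)], so the subtracted constant pays for
       the deficit [M3 + 1 / 2]. *)
    assert (H3 : RInt (fun v => 1 / 2 * exp (- n * (v - t) ^ 2) - (M3 + 1) * exp (- n * d ^ 2)) (t - 2) (t + 2)
       <= RInt (fun v => Re (phi (sigma, v)) * exp (- n * (v - t) ^ 2)) (t - 2) (t + 2)).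
    { apply RInt_le; [lra | | |].
      - apply (ex_RInt_continuous (V := R_CompleteNormedModule)). intros v _.
        apply (continuous_minus (V := R_NormedModule)); [| apply continuous_const].
        apply (continuous_mult (K := R_AbsRing)); [apply continuous_const | apply gaussian_continuous].
      - apply (ex_RInt_continuous (V := R_CompleteNormedModule)).
        rewrite Rmin_left, Rmax_right by lra. intros v Hv'.
        apply (continuous_mult (K := R_AbsRing)); [| apply gaussian_continuous].
        refine (proj1 (continuous_vertical phi sigma v _)). apply Hphi; simpl; lra.
      - intros v Hv'.
        assert (P1 := exp_pos (- n * (v - t) ^ 2)). assert (P2 := exp_pos (- n * d ^ 2)).
        destruct (Rlt_le_dec (Rabs (v - t)) d) as [Hvt | Hvt].
        + specialize (Hre v Hvt). nra.
        + assert (B := Rle_trans _ _ _ (re_le_Cmod _) (HM3' v ltac:(lra))).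
          apply Rabs_le_between in B.
          assert (exp (- n * (v - t) ^ 2) <= exp (- n * d ^ 2)).
          { apply exp_le_exp. rewrite <- (pow2_abs (v - t)).
            assert (d ^ 2 <= Rabs (v - t) ^ 2) by (apply pow_incr; lra). nra. }
          nra. }
    assert (H4 := gaussian_integral_lower n t 2 Hn ltac:(lra)).
    rewrite (RInt_minus (V := R_CompleteNormedModule)
               (fun v => 1 / 2 * exp (- n * (v - t) ^ 2)) (fun _ => (M3 + 1) * exp (- n * d ^ 2))) in H3.
    2:{ apply (ex_RInt_continuous (V := R_CompleteNormedModule)). intros v _.
        apply (continuous_mult (K := R_AbsRing)); [apply continuous_const | apply gaussian_continuous]. }
    2:{ apply ex_RInt_const. }
    rewrite RInt_const in H3.
    rewrite (RInt_scal (V := R_CompleteNormedModule) (fun v => exp (- n * (v - t) ^ 2)) _ _ (1 / 2)) in H3.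
    2:{ apply (ex_RInt_continuous (V := R_CompleteNormedModule)). intros v _. apply gaussian_continuous. }
    unfold minus, plus, opp, scal in H3; simpl in H3; unfold mult in H3; simpl in H3.
    apply Rabs_le_between in H1.
    assert (H5 : exp (- 3 * n) <= exp (- n * d ^ 2)).
    { apply exp_le_exp. assert (d ^ 2 <= 1) by nra. nra. }
    assert (P2 := exp_pos (- n * d ^ 2)). assert (P3 := exp_pos (- 3 * n)).
    assert (H6 : (M1 + M2) * exp (- 3 * n) * h <= (M1 + M2) * exp (- n * d ^ 2) * 2).
    { apply Rmult_le_compat; [| lra | | lra].
      - apply Rmult_le_pos; lra.
      - apply Rmult_le_compat_l; lra. }
    unfold Rdiv in H4. unfold A. simpl pow in *. nra. }
  set (e1 := exp (- 1)). assert (He1 : 0 < e1) by apply exp_pos.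
  (* With [exp_ge_sqr], the estimate [Hmain] yields [n * (e1 * d ^ 4) <= 4 * A]; this [n] just
     violates it. *)
  set (n := 4 * A / (e1 * d ^ 4) + 1).
  assert (Hd4 : 0 < e1 * d ^ 4) by (apply Rmult_lt_0_compat; [exact He1 | now apply pow_lt]).
  assert (Hq : 0 < 4 * A / (e1 * d ^ 4)) by (apply Rdiv_lt_0_compat; lra).
  assert (Hn : 1 <= n) by (unfold n; lra).
  specialize (Hmain n Hn). fold e1 in Hmain.
  assert (Hd2 : 0 < d ^ 2) by now apply pow_lt.
  assert (Hexp := exp_ge_sqr (n * d ^ 2) ltac:(nra)).
  replace (- n * d ^ 2) with (- (n * d ^ 2)) in Hmain by ring.
  rewrite exp_Ropp in Hmain.
  assert (P := exp_pos (n * d ^ 2)).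
  apply (Rmult_le_compat_r (exp (n * d ^ 2) * n)) in Hmain; [| nra].
  replace (A * / exp (n * d ^ 2) * (exp (n * d ^ 2) * n)) with (A * n) in Hmain by (field; lra).
  replace (/ n * e1 * (exp (n * d ^ 2) * n)) with (e1 * exp (n * d ^ 2)) in Hmain by (field; lra).
  assert (Hc1 : e1 * ((n * d ^ 2) ^ 2 / 4) <= A * n).
  { eapply Rle_trans; [| exact Hmain]. apply Rmult_le_compat_l; lra. }
  assert (Hc2 : n * (e1 * d ^ 4) = 4 * A + e1 * d ^ 4) by (unfold n; field; lra).
  nra.
Qed.

(** * Multiple sums over a lattice *)

Lemma Rpower_pos (x y : R) : 0 < Rpower x y.
Proof. apply exp_pos. Qed.

Lemma Rpower_decr (x y rho : R) : 0 < x -> x <= y -> 0 <= rho -> Rpower y (- rho) <= Rpower x (- rho).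
Proof.
  intros Hx Hxy Hr. apply exp_le_exp.
  assert (ln x <= ln y) by (destruct Hxy as [H | ->]; [left; now apply ln_increasing | lra]).
  nra.
Qed.

(** Integral comparison in discrete form: the right-hand side telescopes along an arithmetic
    progression. *)
Lemma Rpower_step (u v rho : R) :
  0 < u -> u <= v -> 1 < rho ->
  (rho - 1) * (v - u) * Rpower v (- rho) <= Rpower u (1 - rho) - Rpower v (1 - rho).
Proof.
  intros Hu Huv Hr.
  destruct (MVT_gen (fun y => Rpower y (1 - rho)) u v (fun y => (1 - rho) * Rpower y (- rho)))
    as [c [Hc E]].
  - rewrite Rmin_left, Rmax_right by exact Huv. intros y Hy.
    replace (- rho) with (1 - rho - 1) by ring. apply is_derive_Reals.
    apply derivable_pt_lim_power. lra.
  - rewrite Rmin_left, Rmax_right by exact Huv. intros y Hy.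
    apply derivable_continuous_pt. eexists. apply derivable_pt_lim_power. lra.
  - rewrite Rmin_left, Rmax_right in Hc by exact Huv.
    assert (D := Rpower_decr c v rho ltac:(lra) ltac:(lra) ltac:(lra)).
    assert (0 <= (rho - 1) * (v - u)) by (apply Rmult_le_pos; lra). nra.
Qed.

(** In the constant, [/ a] pays for the term [m = 0], where one power of [x] is traded using
    [a <= x], and [/ (w * (rho - 1))] for the telescoped rest. Uniformity in [x] allows the bound to
    be iterated over several variables. *)
Lemma power_sum_bound (a w rho : R) :
  0 < a -> 0 < w -> 1 < rho ->
  exists M, 0 < M /\ forall x, a <= x ->
    ex_series (fun m => Rpower (x + INR m * w) (- rho)) /\
    Series (fun m => Rpower (x + INR m * w) (- rho)) <= M * Rpower x (- (rho - 1)).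
Proof.
  intros Ha Hw Hr.
  assert (Hd : 0 < w * (rho - 1)) by (apply Rmult_lt_0_compat; lra).
  exists (/ a + / (w * (rho - 1))). split.
  { apply Rplus_lt_0_compat; now apply Rinv_0_lt_compat. }
  intros x Hx.
  assert (H0 : Rpower x (- rho) <= / a * Rpower x (- (rho - 1))).
  { replace (- rho) with (- (rho - 1) + - (1)) by ring.
    rewrite Rpower_plus, (Rpower_Ropp x 1), Rpower_1 by lra.
    rewrite Rmult_comm. apply Rmult_le_compat_r; [left; apply Rpower_pos |].
    now apply Rinv_le_contravar. }
  assert (HS : forall n, sum_n (fun m => Rpower (x + INR m * w) (- rho)) n <=
     Rpower x (- rho) + / (w * (rho - 1)) * (Rpower x (1 - rho) - Rpower (x + INR n * w) (1 - rho))).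
  { intros n. induction n as [| n IH].
    - rewrite sum_O. simpl. rewrite Rmult_0_l, Rplus_0_r. lra.
    - rewrite sum_Sn. change plus with Rplus. cbv beta.
      assert (Hn := pos_INR n).
      assert (St := Rpower_step (x + INR n * w) (x + INR (S n) * w) rho).
      rewrite S_INR in *.
      assert (P : 0 < x + INR n * w) by nra.
      specialize (St P ltac:(nra) Hr).
      replace ((rho - 1) * (x + (INR n + 1) * w - (x + INR n * w))) with (w * (rho - 1)) in St by ring.
      apply (Rmult_le_compat_l (/ (w * (rho - 1)))) in St; [| left; now apply Rinv_0_lt_compat].
      rewrite <- Rmult_assoc, Rinv_l, Rmult_1_l in St by lra.
      simpl in *. lra. }
  assert (HB : forall n, sum_n (fun m => Rpower (x + INR m * w) (- rho)) n <=
     (/ a + / (w * (rho - 1))) * Rpower x (- (rho - 1))).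
  { intros n. eapply Rle_trans; [apply HS |].
    replace (- (rho - 1)) with (1 - rho) in * by ring.
    assert (0 < / (w * (rho - 1))) by now apply Rinv_0_lt_compat.
    assert (P := Rpower_pos (x + INR n * w) (1 - rho)).
    assert (0 <= / (w * (rho - 1)) * Rpower (x + INR n * w) (1 - rho)) by (apply Rmult_le_pos; lra).
    lra. }
  assert (Hinc : forall n, sum_n (fun m => Rpower (x + INR m * w) (- rho)) n <=
                  sum_n (fun m => Rpower (x + INR m * w) (- rho)) (S n)).
  { intros n. rewrite sum_Sn. change plus with Rplus. cbv beta.
    assert (P := Rpower_pos (x + INR (S n) * w) (- rho)). lra. }
  destruct (ex_finite_lim_seq_incr _ _ Hinc HB) as [l Hl].
  split; [now exists l |].
  rewrite (is_series_unique _ l Hl).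
  apply (is_lim_seq_le _ _ (Finite l) (Finite ((/ a + / (w * (rho - 1))) * Rpower x (- (rho - 1)))) HB Hl).
  apply is_lim_seq_const.
Qed.

(** * Series of complex terms *)

Definition ex_CSeries (u : nat -> C) : Prop :=
  ex_series (fun n => Re (u n)) /\ ex_series (fun n => Im (u n)).

Lemma CSeries_ext (u v : nat -> C) : (forall n, u n = v n) -> CSeries u = CSeries v.
Proof.
  intros H. unfold CSeries. f_equal; apply Series_ext; intros n; now rewrite H.
Qed.

Lemma CSeries_plus (u v : nat -> C) :
  ex_CSeries u -> ex_CSeries v -> CSeries (fun n => u n + v n)%C = (CSeries u + CSeries v)%C.
Proof.
  intros [H1 H2] [H3 H4]. unfold CSeries.
  apply injective_projections; simpl.
  - now rewrite <- Series_plus.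
  - now rewrite <- Series_plus.
Qed.

Lemma CSeries_scal (c : C) (u : nat -> C) :
  ex_CSeries u -> CSeries (fun n => c * u n)%C = (c * CSeries u)%C.
Proof.
  intros [H1 H2]. destruct c as [a b]. unfold CSeries.
  apply injective_projections; simpl.
  - rewrite <- !Series_scal_l, <- Series_minus; [reflexivity | |];
      now apply (ex_series_scal (V := R_NormedModule)).
  - rewrite <- !Series_scal_l, <- Series_plus; [reflexivity | |];
      now apply (ex_series_scal (V := R_NormedModule)).
Qed.

Lemma ex_CSeries_dominated (u : nat -> C) (b : nat -> R) :
  (forall n, Cmod (u n) <= b n) -> ex_series b -> ex_CSeries u.
Proof.
  intros H Hb. split; apply (ex_series_le (K := R_AbsRing) (V := R_CompleteNormedModule) _ b);
    try exact Hb; intros n.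
  - eapply Rle_trans; [apply (re_le_Cmod (u n)) | apply H].
  - eapply Rle_trans; [apply (im_le_Cmod (u n)) | apply H].
Qed.

Lemma Series_Rabs_le (u b : nat -> R) :
  (forall n, Rabs (u n) <= b n) -> ex_series b -> Rabs (Series u) <= Series b.
Proof.
  intros H Hb.
  assert (Ha : ex_series (fun n => Rabs (u n))).
  { apply (ex_series_le (K := R_AbsRing) (V := R_CompleteNormedModule) _ b); [| exact Hb].
    intros n. unfold norm; simpl; unfold abs; simpl. now rewrite Rabs_Rabsolu. }
  eapply Rle_trans; [now apply Series_Rabs |].
  apply Series_le; [| exact Hb]. intros n. split; [apply Rabs_pos | apply H].
Qed.

Lemma Cmod_CSeries_le (u : nat -> C) (b : nat -> R) :
  (forall n, Cmod (u n) <= b n) -> ex_series b -> Cmod (CSeries u) <= 2 * Series b.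
Proof.
  intros H Hb. eapply Rle_trans; [apply Cmod_le_Re_Im |]. simpl.
  replace (2 * Series b) with (Series b + Series b) by ring.
  apply Rplus_le_compat; apply Series_Rabs_le; try exact Hb; intros n.
  - eapply Rle_trans; [apply (re_le_Cmod (u n)) | apply H].
  - eapply Rle_trans; [apply (im_le_Cmod (u n)) | apply H].
Qed.

Lemma is_series_telescope (h : nat -> R) :
  is_lim_seq h 0 -> is_series (fun n => h n - h (S n)) (h 0%nat).
Proof.
  intros H.
  assert (E : forall n, sum_n (fun n => h n - h (S n)) n = h 0%nat - h (S n)).
  { intros n. induction n as [| n IH].
    - now rewrite sum_O.
    - rewrite sum_Sn, IH. unfold plus; simpl. ring. }
  enough (L : is_lim_seq (sum_n (fun n => h n - h (S n))) (h 0%nat)) by exact L.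
  apply (is_lim_seq_ext (fun n => h 0%nat - h (S n))); [intros n; now rewrite E |].
  apply (is_lim_seq_minus _ _ (Finite (h 0%nat)) (Finite 0)).
  - apply is_lim_seq_const.
  - now apply is_lim_seq_incr_1 in H.
  - unfold is_Rbar_minus, is_Rbar_plus; simpl. do 2 f_equal. ring.
Qed.

Lemma CSeries_telescope (h : nat -> C) :
  is_lim_seq (fun n => Cmod (h n)) 0 ->
  CSeries (fun n => h n - h (S n))%C = h 0%nat.
Proof.
  intros H. unfold CSeries.
  assert (Hr : is_lim_seq (fun n => Re (h n)) 0).
  { apply is_lim_seq_abs_0. apply (is_lim_seq_le_le (fun _ => 0) _ (fun n => Cmod (h n)));
      [| apply is_lim_seq_const | exact H].
    intros n. split; [apply Rabs_pos | apply re_le_Cmod]. }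
  assert (Hi : is_lim_seq (fun n => Im (h n)) 0).
  { apply is_lim_seq_abs_0. apply (is_lim_seq_le_le (fun _ => 0) _ (fun n => Cmod (h n)));
      [| apply is_lim_seq_const | exact H].
    intros n. split; [apply Rabs_pos | apply im_le_Cmod]. }
  apply injective_projections; simpl.
  - apply is_series_unique. exact (is_series_telescope _ Hr).
  - apply is_series_unique. exact (is_series_telescope _ Hi).
Qed.

Lemma is_lim_seq_Rpower_0 (x w kappa : R) :
  0 < x -> 0 < w -> 0 < kappa -> is_lim_seq (fun n => Rpower (x + INR n * w) (- kappa)) 0.
Proof.
  intros Hx Hw Hk. apply is_lim_seq_spec. intros [e He]. simpl.
  set (Y := exp (- ln e / kappa)).
  destruct (nfloor_ex (Y / w)) as [N [_ HN]].
  { apply Rdiv_le_0_compat; [left; apply exp_pos | exact Hw]. }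
  exists (S N). intros n Hn. rewrite Rminus_0_r, Rabs_pos_eq by (left; apply Rpower_pos).
  apply le_INR in Hn. rewrite S_INR in Hn.
  assert (HY : Y < x + INR n * w).
  { apply (Rmult_lt_compat_r w) in HN; [| exact Hw].
    replace (Y / w * w) with Y in HN by (field; lra). nra. }
  rewrite <- (exp_ln e He). apply exp_increasing.
  apply ln_increasing in HY; [| apply exp_pos]. unfold Y in HY. rewrite ln_exp in HY.
  apply (Rmult_lt_compat_l kappa) in HY; [| exact Hk].
  replace (kappa * (- ln e / kappa)) with (- ln e) in HY by (field; lra). lra.
Qed.

(** The iterated sum of [barnes_series] with an arbitrary summand, so that powers, kernels and their
    linear combinations are summed over the same lattice. *)
Fixpoint msum (f : R -> C) (x : R) (w : list R) : C :=
  match w with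
  | nil => f x
  | wj :: w' => CSeries (fun m : nat => msum f (x + INR m * wj) w')
  end.

Lemma barnes_series_msum (s : C) (a : R) (w : list R) :
  barnes_series s a w = msum (fun x => / cpow x s)%C a w.
Proof.
  revert a. induction w as [| wj w IH]; intros a; simpl; [reflexivity |].
  apply CSeries_ext. intros m. apply IH.
Qed.

Lemma msum_shift (h : R -> C) (c x : R) (w : list R) :
  msum (fun y => h (y + c)) x w = msum h (x + c) w.
Proof.
  revert x. induction w as [| wj w IH]; intros x; simpl; [reflexivity |].
  apply CSeries_ext. intros m. rewrite IH. f_equal. ring.
Qed.

(** The constant [K] is a parameter rather than existentially quantified, since it will carry the
    dependence on [s] and on the increment [h]. *)
Definition decay (f : R -> C) (a rho K : R) : Prop :=
  forall x, a <= x -> Cmod (f x) <= K * Rpower x (- rho).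

Definition positive (w : list R) : Prop := forall v, In v w -> 0 < v.

Lemma msum_ext (f g : R -> C) (a : R) (w : list R) :
  positive w -> (forall x, a <= x -> f x = g x) -> msum f a w = msum g a w.
Proof.
  revert a. induction w as [| wj w IH]; intros a Hw H; simpl; [apply H; lra |].
  apply CSeries_ext. intros m.
  assert (0 <= INR m * wj).
  { apply Rmult_le_pos; [apply pos_INR | left; apply Hw; now left]. }
  apply IH.
  - intros v Hv. apply Hw. now right.
  - intros x Hx. apply H. lra.
Qed.

(** Every summation costs one power of [x]. Since [M] is chosen before [f] and [K], growth in [s]
    and quadratic smallness in an increment pass unchanged from the summand to the sum. *)
Lemma msum_decay (w : list R) (a rho : R) :
  positive w -> 0 < a -> INR (length w) < rho ->
  exists M, 0 < M /\ forall f K, 0 <= K -> decay f a rho K ->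
    decay (fun x => msum f x w) a (rho - INR (length w)) (M * K).
Proof.
  induction w as [| wj w IH]; intros Hw Ha Hr.
  - exists 1. split; [lra |]. intros f K HK Hf x Hx. simpl.
    rewrite Rminus_0_r, Rmult_1_l. now apply Hf.
  - simpl length in *. rewrite S_INR in *.
    destruct IH as [M [HM HM']].
    + intros v Hv. apply Hw. now right.
    + exact Ha.
    + lra.
    + assert (Hwj : 0 < wj) by (apply Hw; now left).
      destruct (power_sum_bound a wj (rho - INR (length w)) Ha Hwj) as [N [HN HN']]; [lra |].
      exists (2 * M * N). split; [apply Rmult_lt_0_compat; lra |].
      intros f K HK Hf x Hx. destruct (HN' x Hx) as [Hex Hle]. simpl.
      eapply Rle_trans.
      * apply (Cmod_CSeries_le _ (fun m => M * K * Rpower (x + INR m * wj) (- (rho - INR (length w))))).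
        -- intros m. apply (HM' f K HK Hf). assert (Hm := pos_INR m). nra.
        -- now apply (ex_series_scal (V := R_NormedModule)).
      * rewrite Series_scal_l.
        replace (rho - (INR (length w) + 1)) with (rho - INR (length w) - 1) by ring.
        apply (Rmult_le_compat_l (2 * (M * K))) in Hle; [| nra]. lra.
Qed.

Lemma msum_ex_CSeries (f : R -> C) (a x rho K wj : R) (w : list R) :
  positive (wj :: w) -> 0 < a -> a <= x -> INR (length (wj :: w)) < rho -> 0 <= K -> decay f a rho K ->
  ex_CSeries (fun m => msum f (x + INR m * wj) w).
Proof.
  intros Hw Ha Hx Hr HK Hf. simpl length in Hr. rewrite S_INR in Hr.
  assert (Hwj : 0 < wj) by (apply Hw; now left).
  destruct (msum_decay w a rho) as [M [HM HM']].
  - intros v Hv. apply Hw. now right.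
  - exact Ha.
  - lra.
  - destruct (power_sum_bound a wj (rho - INR (length w)) Ha Hwj) as [N [HN HN']]; [lra |].
    apply (ex_CSeries_dominated _
      (fun m => M * K * Rpower (x + INR m * wj) (- (rho - INR (length w))))).
    + intros m. apply (HM' f K HK Hf). assert (Hm := pos_INR m). nra.
    + apply (ex_series_scal (V := R_NormedModule)). now apply HN'.
Qed.

Lemma msum_plus (f g : R -> C) (a x rho K L : R) (w : list R) :
  positive w -> 0 < a -> a <= x -> INR (length w) < rho -> 0 <= K -> 0 <= L ->
  decay f a rho K -> decay g a rho L ->
  msum (fun y => f y + g y)%C x w = (msum f x w + msum g x w)%C.
Proof.
  intros Hw Ha Hx Hr HK HL Hf Hg. revert x Hx.
  induction w as [| wj w IH]; intros x Hx; simpl; [reflexivity |].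
  rewrite <- CSeries_plus.
  - apply CSeries_ext. intros m. apply IH.
    + intros v Hv. apply Hw. now right.
    + simpl length in Hr. rewrite S_INR in Hr. lra.
    + assert (0 < wj) by (apply Hw; now left). assert (Hm := pos_INR m). nra.
  - now apply (msum_ex_CSeries f a x rho K).
  - now apply (msum_ex_CSeries g a x rho L).
Qed.

Lemma msum_scal (c : C) (f : R -> C) (a x rho K : R) (w : list R) :
  positive w -> 0 < a -> a <= x -> INR (length w) < rho -> 0 <= K -> decay f a rho K ->
  msum (fun y => c * f y)%C x w = (c * msum f x w)%C.
Proof.
  intros Hw Ha Hx Hr HK Hf. revert x Hx.
  induction w as [| wj w IH]; intros x Hx; simpl; [reflexivity |].
  rewrite <- CSeries_scal.
  - apply CSeries_ext. intros m. apply IH.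
    + intros v Hv. apply Hw. now right.
    + simpl length in Hr. rewrite S_INR in Hr. lra.
    + assert (0 < wj) by (apply Hw; now left). assert (Hm := pos_INR m). nra.
  - now apply (msum_ex_CSeries f a x rho K).
Qed.

Lemma decay_scal (c : C) (f : R -> C) (a rho K : R) :
  decay f a rho K -> decay (fun y => c * f y)%C a rho (Cmod c * K).
Proof.
  intros H x Hx. rewrite Cmod_mult, Rmult_assoc.
  apply Rmult_le_compat_l; [apply Cmod_ge_0 | now apply H].
Qed.

Lemma decay_plus (f g : R -> C) (a rho K L : R) :
  decay f a rho K -> decay g a rho L -> decay (fun y => f y + g y)%C a rho (K + L).
Proof.
  intros Hf Hg x Hx. eapply Rle_trans; [apply Cmod_triangle |].
  specialize (Hf x Hx). specialize (Hg x Hx). lra.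
Qed.

Lemma decay_shift (f : R -> C) (a c rho K : R) :
  0 < a -> 0 <= c -> 0 <= rho -> 0 <= K -> decay f a rho K -> decay (fun y => f (y + c)) a rho K.
Proof.
  intros Ha Hc Hr HK H x Hx. eapply Rle_trans; [apply H; lra |].
  apply Rmult_le_compat_l; [exact HK |]. apply Rpower_decr; lra.
Qed.

(** The assumed decay makes the inner sums over [w] converge separately for both terms; the outer
    sum then telescopes, since these inner sums tend to 0. The difference is written with [- (1) *]
    so that [msum_plus] and [msum_scal] apply. *)
Lemma msum_telescope (h : R -> C) (a rho K wj : R) (w : list R) :
  positive (wj :: w) -> 0 < a -> INR (length w) < rho -> 0 <= K -> decay h a rho K ->
  msum (fun x => h x + - (1) * h (x + wj)%R)%C a (wj :: w) = msum h a w.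
Proof.
  intros Hw Ha Hr HK Hh.
  assert (Hwj : 0 < wj) by (apply Hw; now left).
  assert (Hw' : positive w) by (intros v Hv; apply Hw; now right).
  assert (Hl := pos_INR (length w)).
  assert (Hsh := decay_shift h a wj rho K Ha ltac:(lra) ltac:(lra) HK Hh).
  simpl.
  transitivity (CSeries (fun m => msum h (a + INR m * wj) w - msum h (a + INR (S m) * wj) w)%C).
  - apply CSeries_ext. intros m. assert (Hm := pos_INR m).
    assert (Hx : a <= a + INR m * wj) by nra.
    rewrite (msum_plus h (fun x => - (1) * h (x + wj)%R)%C a _ rho K (Cmod (- (1)) * K));
      try assumption.
    + rewrite (msum_scal (- (1)) (fun x => h (x + wj)) a _ rho K) by assumption.
      rewrite msum_shift.
      replace (a + INR (S m) * wj) with (a + INR m * wj + wj) by (rewrite S_INR; ring).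
      ring.
    + apply Rmult_le_pos; [apply Cmod_ge_0 | exact HK].
    + now apply decay_scal.
  - rewrite (CSeries_telescope (fun m => msum h (a + INR m * wj) w)).
    + f_equal. simpl. ring.
    + destruct (msum_decay w a rho Hw' Ha Hr) as [M [HM HM']].
      apply (is_lim_seq_le_le (fun _ => 0) _
        (fun n => M * K * Rpower (a + INR n * wj) (- (rho - INR (length w))))).
      * intros n. split; [apply Cmod_ge_0 |]. apply (HM' h K HK Hh).
        assert (Hn := pos_INR n). nra.
      * apply is_lim_seq_const.
      * replace (Finite 0) with (Rbar_mult (M * K) 0) by (simpl; f_equal; ring).
        apply is_lim_seq_scal_l. apply is_lim_seq_Rpower_0; lra.
Qed.

(** * The summation kernel *)

Lemma cpow_plus (y : R) (u v : C) : cpow y (u + v) = (cpow y u * cpow y v)%C.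
Proof. rewrite !cpow_cexp, <- cexp_plus. f_equal. ring. Qed.

Lemma cpow_opp (y : R) (u : C) : cpow y (- u) = (/ cpow y u)%C.
Proof. rewrite !cpow_cexp, <- cexp_opp. f_equal. ring. Qed.

Lemma cpow_1 (y : R) : 0 < y -> cpow y 1 = y.
Proof.
  intros Hy. unfold cpow; simpl. rewrite Rmult_0_l, cos_0, sin_0, Rpower_1 by exact Hy.
  apply injective_projections; simpl; ring.
Qed.

Lemma Cmod_cpow (y : R) (u : C) : Cmod (cpow y u) = Rpower y (Re u).
Proof.
  rewrite cpow_cexp, Cmod_cexp, re_scal_l. unfold Rpower. f_equal. ring.
Qed.

Lemma cpow_pred (y : R) (u : C) : 0 < y -> cpow y (u - 1) = (/ RtoC y * cpow y u)%C.
Proof.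
  intros Hy. replace (u - 1)%C with (u + - (1))%C by ring.
  rewrite cpow_plus, cpow_opp, cpow_1 by exact Hy. ring.
Qed.

Lemma is_derive_ln_inv (y : R) : 0 < y -> is_derive ln y (/ y).
Proof. intros Hy. apply is_derive_Reals. now apply derivable_pt_lim_ln. Qed.

Lemma RCderiv_cpow (u : C) (y : R) :
  0 < y -> RCderiv (fun v => cpow v u) y (u * cpow y (u - 1))%C.
Proof.
  intros Hy.
  eapply RCderiv_ext; [| | apply (RCderiv_cexp ln u y (/ y)); now apply is_derive_ln_inv].
  - intros v. symmetry. apply cpow_cexp.
  - rewrite cpow_pred, cpow_cexp, RtoC_inv by lra. ring.
Qed.

Lemma RCderiv_ln (y : R) : 0 < y -> RCderiv (fun v => RtoC (ln v)) y (/ RtoC y)%C.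
Proof.
  intros Hy. rewrite <- RtoC_inv by lra. apply RCderiv_RtoC. now apply is_derive_ln_inv.
Qed.

(** The successive [y]-derivatives of [y^alpha] and of
    [ln y * y^alpha = d/dalpha y^alpha]. *)
Definition pow0 (al : C) (y : R) : C := cpow y al.
Definition dpow0 (al : C) (y : R) : C := (al * cpow y (al - 1))%C.
Definition ddpow0 (al : C) (y : R) : C := (al * (al - 1) * cpow y (al - 1 - 1))%C.
Definition pow1 (al : C) (y : R) : C := (RtoC (ln y) * cpow y al)%C.
Definition dpow1 (al : C) (y : R) : C := ((1 + al * RtoC (ln y)) * cpow y (al - 1))%C.
Definition ddpow1 (al : C) (y : R) : C :=
  ((2 * al - 1 + al * (al - 1) * RtoC (ln y)) * cpow y (al - 1 - 1))%C.

Lemma RCderiv_pow0 (al : C) (y : R) : 0 < y -> RCderiv (pow0 al) y (dpow0 al y).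
Proof. apply RCderiv_cpow. Qed.

Lemma RCderiv_dpow0 (al : C) (y : R) : 0 < y -> RCderiv (dpow0 al) y (ddpow0 al y).
Proof.
  intros Hy. eapply RCderiv_ext; [reflexivity | | apply RCderiv_scal; now apply RCderiv_cpow].
  unfold ddpow0. ring.
Qed.

Lemma RCderiv_pow1 (al : C) (y : R) : 0 < y -> RCderiv (pow1 al) y (dpow1 al y).
Proof.
  intros Hy. eapply RCderiv_ext;
    [reflexivity | | apply RCderiv_mult; [now apply RCderiv_ln | now apply RCderiv_cpow]].
  unfold dpow1. rewrite cpow_pred by exact Hy. ring.
Qed.

Lemma RCderiv_dpow1 (al : C) (y : R) : 0 < y -> RCderiv (dpow1 al) y (ddpow1 al y).
Proof.
  intros Hy. eapply RCderiv_ext;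
    [reflexivity | | apply RCderiv_mult; [| now apply RCderiv_cpow]].
  2:{ apply RCderiv_plus; [apply RCderiv_const |]. apply RCderiv_scal. now apply RCderiv_ln. }
  unfold ddpow1. rewrite (cpow_pred y (al - 1)) by exact Hy. ring.
Qed.

(** When [dq] is the derivative of [q], this is the mean of [dq] over [[x, x + w]] minus its value
    at the left end, the error of a one-step quadrature rule. *)
Definition trapezoid (w : R) (q dq : R -> C) (x : R) : C :=
  ((q (x + w)%R - q x) / RtoC w - dq x)%C.

(** The mean value inequality is used for [dq], and then for [q y - dq x * y], whose derivative is
    [dq y - dq x]. Its factor 2 enters twice, which gives the 4. *)
Lemma trapezoid_bound (w S x : R) (q dq ddq : R -> C) :
  0 < w ->
  (forall y, x <= y <= x + w ->
     RCderiv q y (dq y) /\ RCderiv dq y (ddq y) /\ Cmod (ddq y) <= S) ->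
  Cmod (trapezoid w q dq x) <= 4 * w * S.
Proof.
  intros Hw H.
  assert (HS : 0 <= S).
  { destruct (H x ltac:(lra)) as (_ & _ & HS). generalize (Cmod_ge_0 (ddq x)). lra. }
  assert (H1 : forall y, x <= y <= x + w -> Cmod (dq y - dq x) <= 2 * S * w).
  { intros y Hy. eapply Rle_trans; [apply (RC_mean_value dq ddq x y S); [lra |] |].
    - intros t Ht. destruct (H t ltac:(lra)) as (_ & A1 & A2). now split.
    - apply Rmult_le_compat_l; lra. }
  assert (H2 := RC_mean_value (fun y => q y + - dq x * RtoC y)%C
                  (fun y => dq y + - dq x * RtoC 1)%C x (x + w) (2 * S * w) ltac:(lra)).
  simpl in H2.
  assert (E : trapezoid w q dq x
    = (/ RtoC w * (q (x + w)%R + - dq x * RtoC (x + w)%R - (q x + - dq x * RtoC x)))%C).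
  { unfold trapezoid. rewrite RtoC_plus. field. apply Cmod_gt_0. rewrite Cmod_R, Rabs_pos_eq; lra. }
  rewrite E, Cmod_mult, Cmod_inv, Cmod_R, Rabs_pos_eq
    by (try lra; apply Cmod_gt_0; rewrite Cmod_R, Rabs_pos_eq; lra).
  eapply Rle_trans.
  - apply Rmult_le_compat_l; [left; now apply Rinv_0_lt_compat | apply H2].
    intros t Ht. split.
    + apply RCderiv_plus; [now apply H |]. apply RCderiv_scal, (RCderiv_RtoC (fun u => u)).
      apply (is_derive_id (K := R_AbsRing)).
    + replace (dq t + - dq x * 1)%C with (dq t - dq x)%C by ring. now apply H1.
  - apply Req_le. field. lra.
Qed.

(** At [al = 1 - s] this is the kernel of the recursion, and [kern1] is its derivative in [al]. *)
Definition kern (w : R) (al : C) : R -> C := trapezoid w (pow0 al) (dpow0 al).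
Definition kern1 (w : R) (al : C) : R -> C := trapezoid w (pow1 al) (dpow1 al).

(** Differentiating in the exponent produces logarithms, and the remainder for an increment [h]
    produces [exp (Cmod h * Rabs (ln y))]. All of it is absorbed at the cost of [eta] in the decay:
    half of [eta] for the exponential, half for the square. *)
Lemma log_power_bound (a eta : R) :
  0 < a -> 0 < eta -> exists delta K, 0 < delta /\ 0 < K /\ forall y, a <= y ->
    (1 + Rabs (ln y)) ^ 2 * exp (delta * Rabs (ln y)) <= K * Rpower y eta.
Proof.
  intros Ha He. set (d := eta / 2). assert (Hd : 0 < d) by (unfold d; lra).
  assert (Hd' : 0 < 2 / d) by (apply Rdiv_lt_0_compat; lra).
  exists d, ((1 + 2 / d) ^ 2 * exp (eta * (2 * Rabs (ln a)))).
  split; [exact Hd |]. split.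
  { apply Rmult_lt_0_compat; [apply pow_lt; lra | apply exp_pos]. }
  intros y Hy. set (v := Rabs (ln y)).
  assert (Hv : 0 <= v) by apply Rabs_pos.
  assert (H1 : 1 + v <= (1 + 2 / d) * exp (d / 2 * v)).
  { assert (1 + d / 2 * v <= exp (d / 2 * v)).
    { destruct Hv as [Hv | <-].
      - left. apply exp_ineq1. nra.
      - rewrite Rmult_0_r, exp_0. lra. }
    assert ((1 + 2 / d) * (1 + d / 2 * v) <= (1 + 2 / d) * exp (d / 2 * v))
      by (apply Rmult_le_compat_l; lra).
    replace ((1 + 2 / d) * (1 + d / 2 * v)) with (1 + v + 2 / d + d / 2 * v) in * by (field; lra).
    nra. }
  (* For [a < 1] the logarithm may be negative, but then it is bounded by [Rabs (ln a)]. *)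
  assert (H2 : v <= ln y + 2 * Rabs (ln a)).
  { assert (ln a <= ln y) by (destruct Hy as [H | ->]; [left; now apply ln_increasing | lra]).
    unfold v. unfold Rabs. destruct Rcase_abs, Rcase_abs; lra. }
  apply Rle_trans with (((1 + 2 / d) * exp (d / 2 * v)) ^ 2 * exp (d * v)).
  { apply Rmult_le_compat_r; [left; apply exp_pos |]. apply pow_incr. lra. }
  replace (((1 + 2 / d) * exp (d / 2 * v)) ^ 2 * exp (d * v)) with ((1 + 2 / d) ^ 2 * exp (eta * v)).
  2:{ replace (eta * v) with (d / 2 * v + d / 2 * v + d * v) by (unfold d; field).
      rewrite !exp_plus. ring. }
  unfold Rpower. rewrite Rmult_assoc, <- exp_plus.
  apply Rmult_le_compat_l; [apply pow_le; lra |].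
  apply exp_le_exp. nra.
Qed.

(** Factoring out [cpow y (al - 1 - 1)] leaves a combination of [E - 1 - L h], [h (E - 1)] and
    [h h E], where [E = cexp (L h)] and [L = ln y]. Each of them is of second order in [h]. *)
Lemma ddpow_remainder_bound (al h : C) (y : R) :
  Cmod (ddpow0 (al + h) y - ddpow0 al y - h * ddpow1 al y) <=
  4 * (Cmod al + 1) ^ 2 * Cmod h ^ 2 *
    ((1 + Rabs (ln y)) ^ 2 * exp (Cmod h * Rabs (ln y))) * Rpower y (Re al - 2).
Proof.
  set (L := RtoC (ln y)). set (E := cexp (L * h)).
  assert (HE : ddpow0 (al + h) y = ((al + h) * (al + h - 1) * (E * cpow y (al - 1 - 1)))%C).
  { unfold ddpow0, E, L. rewrite <- cpow_cexp, <- cpow_plus. do 2 f_equal. ring. }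
  rewrite HE. unfold ddpow0, ddpow1. fold L.
  replace ((al + h) * (al + h - 1) * (E * cpow y (al - 1 - 1)) - al * (al - 1) * cpow y (al - 1 - 1) -
     h * ((2 * al - 1 + al * (al - 1) * L) * cpow y (al - 1 - 1)))%C
    with ((al * (al - 1) * (E - 1 - L * h) + h * (2 * al - 1) * (E - 1) + h * h * E)
           * cpow y (al - 1 - 1))%C by ring.
  rewrite Cmod_mult, Cmod_cpow.
  replace (Re (al - 1 - 1)) with (Re al - 2) by (destruct al; simpl; ring).
  apply Rmult_le_compat_r; [left; apply Rpower_pos |].
  assert (B1 := cexp_sub_1_bound (L * h)). assert (B2 := cexp_taylor_bound (L * h)).
  assert (B3 : Cmod E <= exp (Cmod h * Rabs (ln y))).
  { unfold E. rewrite Cmod_cexp. apply exp_le_exp. eapply Rle_trans; [apply Rle_abs |].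
    eapply Rle_trans; [apply re_le_Cmod |]. unfold L. rewrite Cmod_mult, Cmod_R. lra. }
  fold E in B1, B2. unfold L in B1, B2 at 2 3.
  rewrite Cmod_mult, Cmod_R in B1. rewrite Cmod_mult, Cmod_R in B2.
  rewrite (Rmult_comm (Rabs (ln y)) (Cmod h)) in B1, B2.
  set (H := Cmod h) in *. set (v := Rabs (ln y)) in *. set (X := exp (H * v)) in *.
  assert (HH : 0 <= H) by apply Cmod_ge_0. assert (Hv : 0 <= v) by apply Rabs_pos.
  assert (HX : 0 < X) by apply exp_pos.
  set (A := Cmod al + 1). assert (HA : 1 <= A) by (unfold A; generalize (Cmod_ge_0 al); lra).
  assert (A0 : Cmod al <= A) by (unfold A; lra).
  assert (A1 : Cmod (al - 1) <= A).
  { unfold A. eapply Rle_trans; [apply Cmod_triangle_sub |]. rewrite Cmod_1. lra. }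
  assert (A2 : Cmod (2 * al - 1) <= 2 * A).
  { eapply Rle_trans; [apply Cmod_triangle_sub |].
    rewrite Cmod_mult, Cmod_1, Cmod_R, Rabs_pos_eq by lra. unfold A. lra. }
  assert (T1 : Cmod (al * (al - 1) * (E - 1 - L * h)) <= A * A * (4 * ((H * v) ^ 2 * X))).
  { rewrite !Cmod_mult. apply Rmult_le_compat; try apply Cmod_ge_0.
    - apply Rmult_le_pos; apply Cmod_ge_0.
    - apply Rmult_le_compat; try apply Cmod_ge_0; assumption.
    - exact B2. }
  assert (T2 : Cmod (h * (2 * al - 1) * (E - 1)) <= H * (2 * A) * (2 * (H * v * X))).
  { rewrite !Cmod_mult. apply Rmult_le_compat; try apply Cmod_ge_0.
    - apply Rmult_le_pos; apply Cmod_ge_0.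
    - apply Rmult_le_compat_l; assumption.
    - exact B1. }
  assert (T3 : Cmod (h * h * E) <= H * H * X).
  { rewrite !Cmod_mult. apply Rmult_le_compat_l; [nra | exact B3]. }
  eapply Rle_trans; [apply Cmod_triangle |].
  assert (T4 := Cmod_triangle (al * (al - 1) * (E - 1 - L * h)) (h * (2 * al - 1) * (E - 1))).
  apply Rle_trans with (H ^ 2 * X * (4 * A ^ 2 * v ^ 2 + 4 * A * v + 1)).
  { replace (H ^ 2 * X * (4 * A ^ 2 * v ^ 2 + 4 * A * v + 1)) with
      (A * A * (4 * ((H * v) ^ 2 * X)) + H * (2 * A) * (2 * (H * v * X)) + H * H * X) by ring.
    lra. }
  replace (4 * A ^ 2 * H ^ 2 * ((1 + v) ^ 2 * X)) with (H ^ 2 * X * (4 * A ^ 2 * (1 + v) ^ 2)) by ring.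
  apply Rmult_le_compat_l.
  { apply Rmult_le_pos; [apply pow2_ge_0 | lra]. }
  assert (1 <= A ^ 2) by nra. assert (A <= A ^ 2) by nra.
  assert (A * v <= A ^ 2 * v) by (apply Rmult_le_compat_r; lra).
  assert (0 <= A ^ 2 * v) by (apply Rmult_le_pos; lra). lra.
Qed.

(** All three functions are trapezoid errors, also the remainder, by linearity; so each is
    controlled by a second derivative in [y]. The factor [al (al - 1)] in that derivative is the
    source of the quadratic growth in [al]. *)
Lemma kern_bounds (a w eta : R) :
  0 < a -> 0 < w -> 0 < eta ->
  exists delta K, 0 < delta /\ 0 < K /\ forall al, 0 <= 2 - Re al - eta ->
    decay (kern w al) a (2 - Re al - eta) (K * (Cmod al + 1) ^ 2) /\
    decay (kern1 w al) a (2 - Re al - eta) (K * (Cmod al + 1) ^ 2) /\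
    forall h, Cmod h < delta ->
      decay (fun x => kern w (al + h) x - kern w al x - h * kern1 w al x)%C a (2 - Re al - eta)
            (K * (Cmod al + 1) ^ 2 * Cmod h ^ 2).
Proof.
  intros Ha Hw He. destruct (log_power_bound a eta Ha He) as (d & K & Hd & HK & HB).
  (* The remainder needs the largest constant: 4 from [trapezoid_bound] times 4 from
     [ddpow_remainder_bound]. *)
  exists d, (16 * w * K). split; [exact Hd |]. split; [nra |].
  intros al Hal.
  set (A := Cmod al + 1). assert (HA : 1 <= A) by (unfold A; generalize (Cmod_ge_0 al); lra).
  assert (HA2 : 1 <= A ^ 2) by nra.
  assert (Hp : forall x y, a <= x -> x <= y ->
     K * Rpower y eta * Rpower y (Re al - 2) <= K * Rpower x (- (2 - Re al - eta))).
  { intros x y Hx Hy. rewrite Rmult_assoc, <- Rpower_plus.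
    replace (eta + (Re al - 2)) with (- (2 - Re al - eta)) by ring.
    apply Rmult_le_compat_l; [lra |]. apply Rpower_decr; lra. }
  assert (H1 : forall y, a <= y -> 1 <= exp (d * Rabs (ln y))).
  { intros y Hy. rewrite <- exp_0. apply exp_le_exp. apply Rmult_le_pos; [lra | apply Rabs_pos]. }
  assert (Hdd : forall y, Cmod (cpow y (al - 1 - 1)) = Rpower y (Re al - 2)).
  { intros y. rewrite Cmod_cpow. f_equal. destruct al; simpl; ring. }
  assert (A0 : Cmod al <= A) by (unfold A; lra).
  assert (A1 : Cmod (al - 1) <= A).
  { unfold A. eapply Rle_trans; [apply Cmod_triangle_sub |]. rewrite Cmod_1. lra. }
  assert (AA : Cmod al * Cmod (al - 1) <= A ^ 2).
  { replace (A ^ 2) with (A * A) by ring.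
    apply Rmult_le_compat; try apply Cmod_ge_0; assumption. }
  assert (A2 : Cmod (2 * al - 1) <= 2 * A).
  { eapply Rle_trans; [apply Cmod_triangle_sub |].
    rewrite Cmod_mult, Cmod_1, Cmod_R, Rabs_pos_eq by lra. unfold A. lra. }
  split; [| split].
  - intros x Hx. eapply Rle_trans.
    + apply (trapezoid_bound w (A ^ 2 * (K * Rpower x (- (2 - Re al - eta)))) x _ _ (ddpow0 al) Hw).
      intros y Hy. split; [apply RCderiv_pow0; lra |]. split; [apply RCderiv_dpow0; lra |].
      unfold ddpow0. rewrite !Cmod_mult, Hdd.
      apply Rmult_le_compat; try exact AA.
      * apply Rmult_le_pos; apply Cmod_ge_0.
      * left. apply Rpower_pos.
      * eapply Rle_trans; [| apply (Hp x y); lra].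
        rewrite <- (Rmult_1_l (Rpower y (Re al - 2))) at 1.
        apply Rmult_le_compat_r; [left; apply Rpower_pos |].
        eapply Rle_trans; [| apply HB; lra].
        assert (B := Rabs_pos (ln y)). specialize (H1 y ltac:(lra)). nra.
    + assert (P := Rpower_pos x (- (2 - Re al - eta))).
      assert (0 <= w * (A ^ 2 * (K * Rpower x (- (2 - Re al - eta))))) by
        (repeat apply Rmult_le_pos; lra). lra.
  - intros x Hx. eapply Rle_trans.
    + apply (trapezoid_bound w (2 * A ^ 2 * (K * Rpower x (- (2 - Re al - eta)))) x _ _ (ddpow1 al) Hw).
      intros y Hy. split; [apply RCderiv_pow1; lra |]. split; [apply RCderiv_dpow1; lra |].
      unfold ddpow1. rewrite Cmod_mult, Hdd.
      assert (B := Rabs_pos (ln y)).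
      apply Rle_trans with (2 * A ^ 2 * (1 + Rabs (ln y)) * Rpower y (Re al - 2)).
      * apply Rmult_le_compat_r; [left; apply Rpower_pos |].
        eapply Rle_trans; [apply Cmod_triangle |].
        rewrite !Cmod_mult, Cmod_R.
        assert (Cmod al * Cmod (al - 1) * Rabs (ln y) <= A ^ 2 * Rabs (ln y))
          by now apply Rmult_le_compat_r.
        assert (0 <= A ^ 2 * Rabs (ln y)) by nra. assert (A <= A ^ 2) by nra.
        rewrite !Rmult_plus_distr_l, Rmult_1_r. lra.
      * rewrite !(Rmult_assoc (2 * A ^ 2)). apply Rmult_le_compat_l; [lra |].
        eapply Rle_trans; [| apply (Hp x y); lra].
        apply Rmult_le_compat_r; [left; apply Rpower_pos |].
        eapply Rle_trans; [| apply HB; lra].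
        specialize (H1 y ltac:(lra)). nra.
    + assert (P := Rpower_pos x (- (2 - Re al - eta))).
      assert (0 <= w * (A ^ 2 * (K * Rpower x (- (2 - Re al - eta))))) by
        (repeat apply Rmult_le_pos; lra). lra.
  - intros h Hh x Hx.
    replace (kern w (al + h) x - kern w al x - h * kern1 w al x)%C with
      (trapezoid w (fun y => pow0 (al + h) y + (- (1) * pow0 al y + - h * pow1 al y))%C
                   (fun y => dpow0 (al + h) y + (- (1) * dpow0 al y + - h * dpow1 al y))%C x)
      by (unfold kern, kern1, trapezoid, Cdiv; ring).
    eapply Rle_trans.
    + apply (trapezoid_bound w (4 * A ^ 2 * Cmod h ^ 2 * (K * Rpower x (- (2 - Re al - eta)))) x _ _
        (fun y => ddpow0 (al + h) y + (- (1) * ddpow0 al y + - h * ddpow1 al y))%C Hw).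
      intros y Hy. split; [| split].
      * apply RCderiv_plus; [apply RCderiv_pow0; lra |].
        apply RCderiv_plus; apply RCderiv_scal; [apply RCderiv_pow0 | apply RCderiv_pow1]; lra.
      * apply RCderiv_plus; [apply RCderiv_dpow0; lra |].
        apply RCderiv_plus; apply RCderiv_scal; [apply RCderiv_dpow0 | apply RCderiv_dpow1]; lra.
      * replace (ddpow0 (al + h) y + (- (1) * ddpow0 al y + - h * ddpow1 al y))%C
          with (ddpow0 (al + h) y - ddpow0 al y - h * ddpow1 al y)%C by ring.
        eapply Rle_trans; [apply ddpow_remainder_bound |]. fold A.
        rewrite !(Rmult_assoc (4 * A ^ 2 * Cmod h ^ 2)).
        apply Rmult_le_compat_l.
        { apply Rmult_le_pos; [lra | apply pow2_ge_0]. }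
        eapply Rle_trans; [| apply (Hp x y); lra].
        apply Rmult_le_compat_r; [left; apply Rpower_pos |].
        eapply Rle_trans; [| apply HB; lra].
        apply Rmult_le_compat_l; [apply pow2_ge_0 |].
        apply exp_le_exp. apply Rmult_le_compat_r; [apply Rabs_pos | lra].
    + apply Req_le. ring.
Qed.

Lemma decay_cpow (a : R) (u : C) : decay (fun x => cpow x u) a (- Re u) 1.
Proof. intros x _. rewrite Cmod_cpow, Ropp_involutive. lra. Qed.

(** * Continuation and growth *)

Lemma Cderiv_msum_kern (a v : R) (w : list R) (al : C) :
  0 < a -> 0 < v -> positive w -> Re al < 2 - INR (length w) ->
  Cderiv (fun u => msum (kern v u) a w) al (msum (kern1 v al) a w).
Proof.
  intros Ha Hv Hw Hal.
  (* Half of the available room: [eta] is lost to the logarithms, and what remains still exceeds the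
     number of summations. *)
  set (eta := (2 - Re al - INR (length w)) / 2).
  set (rho := 2 - Re al - eta).
  assert (Hl := pos_INR (length w)).
  assert (Hrho : INR (length w) < rho) by (unfold rho, eta; lra).
  destruct (kern_bounds a v eta Ha Hv) as (d & K & Hd & HK & HB); [unfold eta; lra |].
  destruct (HB al) as (H0 & H1 & H2); [fold rho; lra |]. fold rho in H0, H1, H2.
  destruct (msum_decay w a rho Hw Ha Hrho) as [M [HM HM']].
  set (A := (Cmod al + 1) ^ 2) in *.
  assert (HA : 0 <= A) by apply pow2_ge_0.
  assert (HKA : 0 <= K * A) by (apply Rmult_le_pos; lra).
  apply (Cderiv_of_quadratic _ _ _ d (M * (K * A) * Rpower a (- (rho - INR (length w)))) Hd).
  intros h Hh. specialize (H2 h Hh).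
  assert (HKh : 0 <= K * A * Cmod h ^ 2) by (apply Rmult_le_pos; [exact HKA | apply pow2_ge_0]).
  set (rem := fun x => (kern v (al + h) x - kern v al x - h * kern1 v al x)%C) in H2.
  assert (E : msum (kern v (al + h)%C) a w
    = (msum rem a w + (msum (kern v al) a w + h * msum (kern1 v al) a w))%C).
  { rewrite <- (msum_scal h (kern1 v al) a a rho (K * A)) by (assumption || lra).
    rewrite <- (msum_plus (kern v al) (fun y => h * kern1 v al y)%C a a rho (K * A) (Cmod h * (K * A)));
      try (assumption || lra).
    - rewrite <- (msum_plus rem _ a a rho (K * A * Cmod h ^ 2) (K * A + Cmod h * (K * A)));
        try (assumption || lra).
      + apply msum_ext; [exact Hw |]. intros x Hx. unfold rem. ring.
      + apply Rplus_le_le_0_compat; [exact HKA |].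
        apply Rmult_le_pos; [apply Cmod_ge_0 | exact HKA].
      + apply decay_plus; [exact H0 |]. now apply decay_scal.
    - apply Rmult_le_pos; [apply Cmod_ge_0 | exact HKA].
    - now apply decay_scal. }
  rewrite E.
  replace (msum rem a w + (msum (kern v al) a w + h * msum (kern1 v al) a w) - msum (kern v al) a w
           - msum (kern1 v al) a w * h)%C with (msum rem a w) by ring.
  eapply Rle_trans; [apply (HM' rem _ HKh H2); lra |]. apply Req_le. ring.
Qed.

(** * Polynomial growth on vertical lines *)

Definition poly_growth (F : C -> C) (sigma : R) : Prop :=
  exists (K : R) (n : nat), 0 <= K /\ forall t, 1 <= t -> Cmod (F (sigma, t)) <= K * t ^ n.

Lemma poly_growth_bounded (F : C -> C) (sigma K : R) :
  (forall t, 1 <= t -> Cmod (F (sigma, t)) <= K) -> poly_growth F sigma.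
Proof.
  intros H. exists K, 0%nat. split.
  - specialize (H 1 (Rle_refl 1)). generalize (Cmod_ge_0 (F (sigma, 1))). lra.
  - intros t Ht. simpl. rewrite Rmult_1_r. now apply H.
Qed.

Lemma poly_growth_plus (F G : C -> C) (sigma : R) :
  poly_growth F sigma -> poly_growth G sigma -> poly_growth (fun s => F s + G s)%C sigma.
Proof.
  intros (K & n & HK & HF) (L & m & HL & HG). exists (K + L), (n + m)%nat. split; [lra |].
  intros t Ht. eapply Rle_trans; [apply Cmod_triangle |].
  rewrite Rmult_plus_distr_r. specialize (HF t Ht). specialize (HG t Ht).
  assert (t ^ n <= t ^ (n + m)) by (apply Rle_pow; [exact Ht | lia]).
  assert (t ^ m <= t ^ (n + m)) by (apply Rle_pow; [exact Ht | lia]).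
  apply Rplus_le_compat; (eapply Rle_trans; [eassumption |]); now apply Rmult_le_compat_l.
Qed.

Lemma poly_growth_mult (F G : C -> C) (sigma : R) :
  poly_growth F sigma -> poly_growth G sigma -> poly_growth (fun s => F s * G s)%C sigma.
Proof.
  intros (K & n & HK & HF) (L & m & HL & HG). exists (K * L), (n + m)%nat. split; [nra |].
  intros t Ht. rewrite Cmod_mult, pow_add.
  replace (K * L * (t ^ n * t ^ m)) with ((K * t ^ n) * (L * t ^ m)) by ring.
  apply Rmult_le_compat; try apply Cmod_ge_0; auto.
Qed.

(** The derivative is carried along with its own growth bound, so that the product and chain rules
    propagate the bound. The degree may depend on the vertical line. *)
Definition tempered (c : R) (F F1 : C -> C) : Prop :=
  (forall s, c < Re s -> 0 < Im s -> Cderiv F s (F1 s)) /\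
  forall sigma, c < sigma -> poly_growth F sigma /\ poly_growth F1 sigma.

Lemma tempered_plus (c : R) (F F1 G G1 : C -> C) :
  tempered c F F1 -> tempered c G G1 ->
  tempered c (fun s => F s + G s)%C (fun s => F1 s + G1 s)%C.
Proof.
  intros [H1 H2] [H3 H4]. split.
  - intros s Hs Hi. apply Cderiv_plus; auto.
  - intros sigma Hs. destruct (H2 sigma Hs), (H4 sigma Hs).
    split; now apply poly_growth_plus.
Qed.

Lemma tempered_mult (c : R) (F F1 G G1 : C -> C) :
  tempered c F F1 -> tempered c G G1 ->
  tempered c (fun s => F s * G s)%C (fun s => F1 s * G s + F s * G1 s)%C.
Proof.
  intros [H1 H2] [H3 H4]. split.
  - intros s Hs Hi. apply Cderiv_mult; auto.
  - intros sigma Hs. destruct (H2 sigma Hs), (H4 sigma Hs).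
    split; [now apply poly_growth_mult |].
    apply poly_growth_plus; now apply poly_growth_mult.
Qed.

Lemma tempered_const (c : R) (k : C) : tempered c (fun _ => k) (fun _ => 0).
Proof.
  split.
  - intros s _ _. apply Cderiv_const.
  - intros sigma _. split.
    + apply poly_growth_bounded with (Cmod k). intros; lra.
    + apply poly_growth_bounded with 0. intros; rewrite Cmod_0; lra.
Qed.

Lemma tempered_shift (c : R) (F F1 : C -> C) :
  tempered c F F1 -> tempered (c + 1) (fun s => F (s - 1)%C) (fun s => F1 (s - 1)%C).
Proof.
  intros [H1 H2].
  assert (E : forall sigma t, ((sigma, t) - 1)%C = (sigma - 1, t)).
  { intros sigma t. apply injective_projections; simpl; ring. }
  split.
  - intros s Hs Hi.
    replace (F1 (s - 1)%C) with ((1 - 0) * F1 (s - 1)%C)%C by ring.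
    apply (Cderiv_comp F (fun s => s - 1)%C).
    + apply H1; destruct s; simpl in *; lra.
    + apply Cderiv_minus; [apply Cderiv_id | apply Cderiv_const].
  - intros sigma Hs. destruct (H2 (sigma - 1)) as [(K & n & HK & HF) (L & m & HL & HG)]; [lra |].
    split; [exists K, n | exists L, m]; (split; [assumption |]); intros t Ht; rewrite E; auto.
Qed.

Lemma Cderiv_inv (z : C) : z <> 0 -> Cderiv (fun s => / s)%C z (- (/ z * / z))%C.
Proof.
  intros Hz. assert (Hm : 0 < Cmod z) by now apply Cmod_gt_0.
  apply (Cderiv_of_quadratic _ _ _ (Cmod z / 2) (/ Cmod z * / Cmod z * (2 * / Cmod z))); [lra |].
  intros h Hh.
  assert (Hzh : Cmod z / 2 <= Cmod (z + h)).
  { assert (T := Cmod_triangle_sub (z + h) h). replace (z + h - h)%C with z in T by ring. lra. }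
  assert (Hzh0 : (z + h)%C <> 0) by (apply Cmod_gt_0; lra).
  replace (/ (z + h) - / z - - (/ z * / z) * h)%C with (/ z * / z * / (z + h) * (h * h))%C
    by (field; now split).
  rewrite !Cmod_mult, !Cmod_inv by assumption.
  replace (Cmod h ^ 2) with (Cmod h * Cmod h) by ring.
  apply Rmult_le_compat_r; [apply Rmult_le_pos; apply Cmod_ge_0 |].
  assert (0 < / Cmod z) by now apply Rinv_0_lt_compat.
  apply Rmult_le_compat_l; [apply Rmult_le_pos; lra |].
  replace (2 * / Cmod z) with (/ (Cmod z / 2)) by (field; lra).
  apply Rinv_le_contravar; lra.
Qed.

Lemma Cmod_inv_pred_le_1 (sigma t : R) : 1 <= t -> Cmod (/ ((sigma, t) - 1)) <= 1.
Proof.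
  intros Ht.
  assert (H : 1 <= Cmod ((sigma, t) - 1)).
  { eapply Rle_trans; [| apply im_le_Cmod]. simpl.
    replace (t + - 0) with t by ring. rewrite Rabs_pos_eq; lra. }
  rewrite Cmod_inv by (apply Cmod_gt_0; lra).
  apply Rle_trans with (/ 1); [apply Rinv_le_contravar; lra | rewrite Rinv_1; lra].
Qed.

Lemma tempered_inv_pred (c : R) :
  tempered c (fun s => / (s - 1))%C (fun s => - (/ (s - 1) * / (s - 1)))%C.
Proof.
  split.
  - intros s _ Hi.
    replace (- (/ (s - 1) * / (s - 1)))%C with ((1 - 0) * - (/ (s - 1) * / (s - 1)))%C by ring.
    apply (Cderiv_comp (fun z => / z)%C (fun s => s - 1)%C).
    + apply Cderiv_inv. intros E. apply (f_equal Im) in E.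
      destruct s; simpl in *. lra.
    + apply Cderiv_minus; [apply Cderiv_id | apply Cderiv_const].
  - intros sigma _. split; apply poly_growth_bounded with 1; intros t Ht.
    + now apply Cmod_inv_pred_le_1.
    + rewrite Cmod_opp, Cmod_mult. assert (H := Cmod_inv_pred_le_1 sigma t Ht).
      assert (H0 := Cmod_ge_0 (/ ((sigma, t) - 1))). nra.
Qed.

Lemma poly_growth_msum_kern (a v : R) (w : list R) (sigma : R) :
  0 < a -> 0 < v -> positive w -> INR (length w) - 1 < sigma ->
  poly_growth (fun s => msum (kern v (1 - s)%C) a w) sigma /\
  poly_growth (fun s => - msum (kern1 v (1 - s)%C) a w)%C sigma.
Proof.
  intros Ha Hv Hw Hs.
  set (eta := (sigma + 1 - INR (length w)) / 2).
  set (rho := sigma + 1 - eta).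
  assert (Hl := pos_INR (length w)).
  assert (Hrho : INR (length w) < rho) by (unfold rho, eta; lra).
  destruct (kern_bounds a v eta Ha Hv) as (d & K & Hd & HK & HB); [unfold eta; lra |].
  destruct (msum_decay w a rho Hw Ha Hrho) as [M [HM HM']].
  set (P := Rpower a (- (rho - INR (length w)))).
  assert (HP : 0 < P) by apply Rpower_pos.
  (* For [1 <= t] one has [Cmod (1 - (sigma, t)) + 1 <= 2 + Rabs sigma + t <= B * t]. *)
  set (B := Rabs sigma + 3). assert (HB0 : 3 <= B) by (unfold B; generalize (Rabs_pos sigma); lra).
  assert (HMK : 0 < M * K * P) by (repeat apply Rmult_lt_0_compat; assumption).
  assert (HC : forall t, 1 <= t -> (Cmod (1 - (sigma, t)) + 1) ^ 2 <= B ^ 2 * t ^ 2).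
  { intros t Ht. rewrite <- Rpow_mult_distr. apply pow_incr. split.
    - generalize (Cmod_ge_0 (1 - (sigma, t))). lra.
    - assert (T := Cmod_triangle_sub 1 (sigma, t)). rewrite Cmod_1 in T.
      assert (T' := Cmod_le_Re_Im (sigma, t)). simpl in T'.
      rewrite (Rabs_pos_eq t) in T' by lra. unfold B.
      assert (0 <= Rabs sigma) by apply Rabs_pos. nra. }
  assert (HD : forall t (f : R -> C), 1 <= t ->
     decay f a rho (K * (Cmod (1 - (sigma, t)) + 1) ^ 2) ->
     Cmod (msum f a w) <= (M * K * P * B ^ 2) * t ^ 2).
  { intros t f Ht Hf. eapply Rle_trans; [apply (HM' f _) with (2 := Hf); try lra |].
    - apply Rmult_le_pos; [lra | apply pow2_ge_0].
    - fold P. specialize (HC t Ht). nra. }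
  assert (Hal : forall t, 2 - Re (1 - (sigma, t))%C - eta = rho).
  { intros t. unfold rho. simpl. ring. }
  split; exists (M * K * P * B ^ 2), 2%nat;
    (split; [apply Rmult_le_pos; [lra | apply pow2_ge_0] |]); intros t Ht.
  - apply HD; [exact Ht |]. rewrite <- (Hal t). apply HB. rewrite Hal. lra.
  - rewrite Cmod_opp. apply HD; [exact Ht |].
    rewrite <- (Hal t). apply HB. rewrite Hal. lra.
Qed.

Lemma tempered_msum_kern (a v : R) (w : list R) :
  0 < a -> 0 < v -> positive w ->
  tempered (INR (length w) - 1) (fun s => msum (kern v (1 - s)%C) a w)
    (fun s => - msum (kern1 v (1 - s)%C) a w)%C.
Proof.
  intros Ha Hv Hw. split.
  - intros s Hs _.
    replace (- msum (kern1 v (1 - s)%C) a w)%C with ((0 - 1) * msum (kern1 v (1 - s)%C) a w)%C by ring.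
    apply (Cderiv_comp (fun u => msum (kern v u) a w) (fun s => 1 - s)%C).
    + apply Cderiv_msum_kern; try assumption. destruct s; simpl in *. lra.
    + apply Cderiv_minus; [apply Cderiv_const | apply Cderiv_id].
  - intros sigma Hs. now apply poly_growth_msum_kern.
Qed.

Lemma tempered_cpow_opp (c a : R) :
  tempered c (fun s => / cpow a s)%C (fun s => - RtoC (ln a) * / cpow a s)%C.
Proof.
  assert (E : forall s, (/ cpow a s)%C = cexp (- RtoC (ln a) * s)%C).
  { intros s. rewrite <- cpow_opp, cpow_cexp. f_equal. ring. }
  assert (B : forall sigma t, Cmod (/ cpow a (sigma, t)) = Rpower a (- sigma)).
  { intros sigma t. rewrite <- cpow_opp, Cmod_cpow. reflexivity. }
  split.
  - intros s _ _. apply (Cderiv_ext (fun s => cexp (- RtoC (ln a) * s)%C)).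
    + intros w. now rewrite E.
    + rewrite E.
      replace (- RtoC (ln a) * cexp (- RtoC (ln a) * s))%C with
        ((0 * s + - RtoC (ln a) * 1) * cexp (- RtoC (ln a) * s))%C by ring.
      apply (Cderiv_comp cexp (fun s => - RtoC (ln a) * s)%C); [apply Cderiv_cexp |].
      apply (Cderiv_mult (fun _ => - RtoC (ln a))%C (fun s => s)); [apply Cderiv_const | apply Cderiv_id].
  - intros sigma _. split.
    + apply poly_growth_bounded with (Rpower a (- sigma)). intros t _. rewrite B. lra.
    + apply poly_growth_bounded with (Cmod (- RtoC (ln a)) * Rpower a (- sigma)).
      intros t _. rewrite Cmod_mult, B. lra.
Qed.

(** Summing [x^(1-s) - (x + v)^(1-s)] over the lattice telescopes in the
    direction of [v] and leaves a Barnes series with one variable less. *)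
Lemma barnes_recursion (s : C) (a v : R) (w : list R) :
  0 < a -> positive (v :: w) -> INR (length (v :: w)) < Re s ->
  ((s - 1) * barnes_series s a (v :: w))%C =
  (msum (kern v (1 - s)%C) a (v :: w) + / RtoC v * barnes_series (s - 1) a w)%C.
Proof.
  intros Ha Hw Hs.
  assert (Hv : 0 < v) by (apply Hw; now left).
  assert (Hw' : positive w) by (intros u Hu; apply Hw; now right).
  assert (Hl := pos_INR (length w)).
  assert (Hlen : INR (length (v :: w)) = INR (length w) + 1) by (simpl length; apply S_INR).
  assert (Hv0 : RtoC v <> 0) by (apply Cmod_gt_0; rewrite Cmod_R, Rabs_pos_eq; lra).
  rewrite !barnes_series_msum.
  set (f := fun x => cpow x (- s)).
  set (h := fun x => cpow x (1 - s)%C).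
  set (rho := Re s).
  assert (Hf : decay f a rho 1).
  { unfold rho. rewrite <- (Ropp_involutive (Re s)), <- re_opp. apply decay_cpow. }
  assert (Hh : decay h a (rho - 1) 1).
  { replace (rho - 1) with (- Re (1 - s)%C) by (unfold rho; destruct s; simpl; ring).
    apply decay_cpow. }
  assert (Hk : exists K, 0 <= K /\ decay (kern v (1 - s)%C) a rho K).
  (* Here a whole power of decay can be given away: the exponent left is [Re s], the same as for the
     Barnes summand [f]. *)
  { set (eta := 1). destruct (kern_bounds a v eta Ha Hv) as (d & K & _ & HK & HB); [unfold eta; lra |].
    assert (E : 2 - Re (1 - s)%C - eta = rho) by (unfold eta, rho; destruct s; simpl; ring).
    destruct (HB (1 - s)%C) as (H0 & _ & _); [rewrite E; unfold rho; lra |].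
    rewrite E in H0.
    exists (K * (Cmod (1 - s) + 1) ^ 2). split; [| exact H0].
    apply Rmult_le_pos; [lra | apply pow2_ge_0]. }
  destruct Hk as (K & HK & Hk).
  rewrite (msum_ext (fun x => / cpow x s)%C f a (v :: w) Hw) by (intros x _; unfold f; now rewrite cpow_opp).
  rewrite (msum_ext (fun x => / cpow x (s - 1))%C h a w Hw').
  2:{ intros x _. unfold h. rewrite <- cpow_opp. f_equal. ring. }
  rewrite <- (msum_telescope h a (rho - 1) 1 v w Hw Ha) by (unfold rho; try assumption; lra).
  (* The definition of the kernel solved for the difference of consecutive values of [h]. *)
  rewrite (msum_ext (fun x => h x + - (1) * h (x + v)%R)%C
             (fun x => RtoC v * ((s - 1) * f x + - (1) * kern v (1 - s) x))%C a (v :: w) Hw).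
  2:{ intros x Hx. unfold kern, trapezoid, pow0, dpow0. fold (h x) (h (x + v)).
      replace (1 - s - 1)%C with (- s)%C by ring. fold (f x). field. exact Hv0. }
  assert (HM : Cmod (- (1)) * K = K) by (rewrite Cmod_opp, Cmod_1; ring).
  assert (D1 : decay (fun x => (s - 1) * f x)%C a rho (Cmod (s - 1) * 1)) by now apply decay_scal.
  assert (D2 : decay (fun x => - (1) * kern v (1 - s) x)%C a rho (Cmod (- (1)) * K)) by now apply decay_scal.
  assert (P1 : 0 <= Cmod (s - 1) * 1) by (rewrite Rmult_1_r; apply Cmod_ge_0).
  rewrite (msum_scal (RtoC v) _ a a rho (Cmod (s - 1) * 1 + Cmod (- (1)) * K));
    try assumption; try (unfold rho; lra); [| now apply decay_plus].
  rewrite (msum_plus _ _ a a rho (Cmod (s - 1) * 1) (Cmod (- (1)) * K));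
    try assumption; try (unfold rho; lra).
  rewrite (msum_scal (s - 1) f a a rho 1); try assumption; try (unfold rho; lra).
  rewrite (msum_scal (- (1)) (kern v (1 - s)%C) a a rho K); try assumption; try (unfold rho; lra).
  field. exact Hv0.
Qed.

(** Induction on the variables with the recursion divided by [s - 1]. A new variable moves the
    boundary abscissa by one, and so does the shift of the previous continuation to [s - 1], so both
    summands are tempered on the same half-plane. *)
Lemma barnes_continuation (a : R) (w : list R) :
  0 < a -> positive w ->
  exists F F1, tempered (INR (length w) - 1) F F1 /\
    forall s, INR (length w) < Re s -> 0 < Im s -> F s = barnes_series s a w.
Proof.
  intros Ha. induction w as [| v w IH]; intros Hw.
  - exists (fun s => / cpow a s)%C, (fun s => - RtoC (ln a) * / cpow a s)%C.
    split; [apply tempered_cpow_opp | reflexivity].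
  - destruct IH as (F & F1 & HF & HFs); [intros u Hu; apply Hw; now right |].
    assert (Hv : 0 < v) by (apply Hw; now left).
    assert (Hlen : INR (length (v :: w)) = INR (length w) + 1) by (simpl length; apply S_INR).
    assert (HF' := tempered_shift _ _ _ HF).
    replace (INR (length w) - 1 + 1) with (INR (length (v :: w)) - 1) in HF' by (rewrite Hlen; ring).
    assert (T := tempered_mult _ _ _ _ _ (tempered_inv_pred (INR (length (v :: w)) - 1))
      (tempered_plus _ _ _ _ _ (tempered_msum_kern a v (v :: w) Ha Hv Hw)
         (tempered_mult _ _ _ _ _ (tempered_const _ (/ RtoC v)) HF'))).
    eexists. eexists. split; [exact T |]. intros s Hs Hi. cbv beta.
    rewrite HFs by (destruct s; simpl in Hs, Hi |- *; simpl in Hlen; lra).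
    rewrite <- barnes_recursion by assumption.
    field. intros E. apply (f_equal Im) in E. destruct s; simpl in *. lra.
Qed.

(** * Lipschitz bounds on vertical lines *)

Lemma is_derive_of_eps (g : R -> R) (t d : R) :
  (forall eps, 0 < eps -> exists delta, 0 < delta /\
     forall u, Rabs (u - t) < delta -> Rabs (g u - g t - d * (u - t)) <= eps * Rabs (u - t)) ->
  is_derive g t d.
Proof.
  intros H. split; [apply is_linear_scal_l |].
  intros x Hx eps. apply (is_filter_lim_locally_unique (V := R_NormedModule)) in Hx. subst x.
  destruct (H eps (cond_pos eps)) as [e [He H']].
  exists (mkposreal e He). intros u Hu.
  specialize (H' u Hu). rewrite (Rmult_comm d) in H'. exact H'.
Qed.

Lemma RCderiv_vertical (F : C -> C) (sigma t : R) (l : C) :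
  Cderiv F (sigma, t) l -> RCderiv (fun u => F (sigma, u)) t (Ci * l)%C.
Proof.
  intros H. split; apply is_derive_of_eps; intros eps Heps;
    destruct (H eps Heps) as [d [Hd H']]; exists d; (split; [exact Hd |]); intros u Hu;
    specialize (H' (sigma, u)); rewrite Cmod_vertical in H'; specialize (H' Hu);
    (eapply Rle_trans; [| exact H']).
  - eapply Rle_trans; [| apply re_le_Cmod]. apply Req_le. f_equal.
    destruct l; simpl; unfold Re, Im; ring.
  - eapply Rle_trans; [| apply im_le_Cmod]. apply Req_le. f_equal.
    destruct l; simpl; unfold Re, Im; ring.
Qed.

Lemma tempered_lipschitz (c sigma : R) (F F1 : C -> C) :
  tempered c F F1 -> c < sigma ->
  exists (E : R) (n : nat), 1 <= E /\ forall tau t, 1 <= tau -> tau <= t <= tau + 1 ->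
    Cmod (F (sigma, t) - F (sigma, tau)) <= E * tau ^ n * (t - tau).
Proof.
  intros [H1 H2] Hs. destruct (H2 sigma Hs) as [_ (L & n & HL & HB)].
  (* The 2 comes from [RC_mean_value], and [2 ^ n] from [u <= tau + 1 <= 2 * tau]; adding 1 ensures
     [1 <= E]. *)
  exists (2 * L * 2 ^ n + 1), n. split.
  { assert (0 < 2 ^ n) by (apply pow_lt; lra). nra. }
  intros tau t Ht Htt.
  apply Rle_trans with (2 * (L * 2 ^ n * tau ^ n) * (t - tau)).
  - apply (RC_mean_value (fun u => F (sigma, u)) (fun u => Ci * F1 (sigma, u))%C); [lra |].
    intros u Hu. split; [apply RCderiv_vertical, H1; simpl; lra |].
    rewrite Cmod_mult, Cmod_Ci, Rmult_1_l.
    eapply Rle_trans; [apply HB; lra |].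
    rewrite Rmult_assoc, <- Rpow_mult_distr.
    apply Rmult_le_compat_l; [exact HL |]. apply pow_incr. lra.
  - apply Rmult_le_compat_r; [lra |].
    assert (0 < tau ^ n) by (apply pow_lt; lra). lra.
Qed.

Lemma Cmod_reverse_triangle (x y : C) : Rabs (Cmod x - Cmod y) <= Cmod (x - y).
Proof.
  apply Rabs_le. split.
  - assert (T := Cmod_triangle_sub x (x - y)). replace (x - (x - y))%C with y in T by ring. lra.
  - assert (T := Cmod_triangle (x - y) y). replace (x - y + y)%C with x in T by ring. lra.
Qed.

Lemma continuous_Cmod_pow_vertical (f : C -> C) (sigma t : R) (m : nat) :
  (exists l, Cderiv f (sigma, t) l) -> continuous (fun u => Cmod (f (sigma, u)) ^ m) t.
Proof.
  intros [l Hl]. apply (continuous_comp (fun u => Cmod (f (sigma, u))) (fun x => x ^ m)).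
  - apply continuous_of_eps. intros eps Heps.
    destruct (Cderiv_continuous _ _ _ Hl eps Heps) as [d [Hd H]].
    exists d. split; [exact Hd |]. intros u Hu.
    eapply Rle_lt_trans; [apply Cmod_reverse_triangle |].
    apply H. now rewrite Cmod_vertical.
  - apply (ex_derive_continuous (K := R_AbsRing) (V := R_NormedModule)). auto_derive. exact I.
Qed.

Lemma Rpower_pow_mult (x e : R) (m : nat) : 0 < x -> Rpower x e ^ m = Rpower x (e * INR m).
Proof.
  intros Hx. rewrite <- Rpower_pow by apply Rpower_pos. now rewrite Rpower_mult.
Qed.

Lemma Rpower_exponent_le (x e e' : R) : 1 <= x -> e <= e' -> Rpower x e <= Rpower x e'.
Proof.
  intros [Hx | <-] He; [now apply Rle_Rpower; [lra |] |].
  unfold Rpower. rewrite ln_1, !Rmult_0_r. lra.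
Qed.

Lemma Rpower_ge_1 (x e : R) : 1 <= x -> 0 <= e -> 1 <= Rpower x e.
Proof.
  intros Hx He. rewrite <- (Rpower_O x) by lra. now apply Rpower_exponent_le.
Qed.

(** * Moments and pointwise bounds *)

(** With the exponent [eps / (2k)] the [2k]-th power is [O(t^eps)], and integration costs one factor
    [T]. The initial segment, where the asymptotic bound says nothing, is covered by continuity. *)
Lemma moment_bound_of_pointwise (f : C -> C) (sigma : R) (k : nat) (eps : R) :
  (forall s, Re s = sigma -> 0 < Im s -> exists l, Cderiv f s l) ->
  (1 <= k)%nat -> 0 < eps ->
  big_O (fun t => Cmod (f (sigma, t))) (fun t => Rpower t (eps / INR (2 * k))) ->
  big_O (fun T => RInt (fun t => Cmod (f (sigma, t)) ^ (2 * k)) 2 T) (fun T => Rpower T (1 + eps)).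
Proof.
  intros Hf Hk Heps [K [T0 H0]].
  assert (Hk0 : 0 < INR (2 * k)) by (apply lt_0_INR; lia).
  set (T1 := Rmax T0 2 + 1).
  assert (HT1 : 2 <= T1 /\ T0 < T1).
  { unfold T1. generalize (Rmax_l T0 2) (Rmax_r T0 2). lra. }
  destruct (Cmod_bounded_vertical f 2 T1 sigma) as [M [HM HM']];
    [lra | intros t Ht; apply Hf; simpl; lra |].
  exists (M ^ (2 * k) + Rabs K ^ (2 * k)), T1. intros T HT.
  assert (Hpt : forall t, 2 <= t <= T ->
     Cmod (f (sigma, t)) ^ (2 * k) <= (M ^ (2 * k) + Rabs K ^ (2 * k)) * Rpower T eps).
  { intros t Ht.
    assert (P0 : 1 <= Rpower T eps) by (apply Rpower_ge_1; lra).
    assert (P1 : 0 <= M ^ (2 * k)) by (apply pow_le; lra).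
    assert (P2 : 0 <= Rabs K ^ (2 * k)) by (apply pow_le, Rabs_pos).
    destruct (Rle_lt_dec t T1) as [Hle | Hlt].
    - apply Rle_trans with (M ^ (2 * k)); [| nra].
      apply pow_incr. split; [apply Cmod_ge_0 |]. apply HM'. lra.
    - specialize (H0 t ltac:(lra)).
      rewrite !Rabs_pos_eq in H0 by (try apply Cmod_ge_0; left; apply Rpower_pos).
      apply Rle_trans with ((Rabs K * Rpower t (eps / INR (2 * k))) ^ (2 * k)).
      + apply pow_incr. split; [apply Cmod_ge_0 |]. eapply Rle_trans; [exact H0 |].
        apply Rmult_le_compat_r; [left; apply Rpower_pos | apply Rle_abs].
      + rewrite Rpow_mult_distr, Rpower_pow_mult by lra.
        replace (eps / INR (2 * k) * INR (2 * k)) with eps by (field; lra).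
        assert (Rpower t eps <= Rpower T eps) by (apply Rle_Rpower_l; lra).
        assert (P3 := Rpower_pos t eps). nra. }
  assert (B : Rabs (RInt (fun t => Cmod (f (sigma, t)) ^ (2 * k)) 2 T - 0 * (T - 2))
     <= ((M ^ (2 * k) + Rabs K ^ (2 * k)) * Rpower T eps) * (T - 2)).
  { apply RInt_near_const; [lra | |].
    - intros t Ht. apply continuous_Cmod_pow_vertical. apply Hf; simpl; lra.
    - intros t Ht. rewrite Rminus_0_r, Rabs_pos_eq by (apply pow_le, Cmod_ge_0). now apply Hpt. }
  rewrite Rmult_0_l, Rminus_0_r in B.
  eapply Rle_trans; [exact B |].
  rewrite (Rabs_pos_eq (Rpower T (1 + eps))) by (left; apply Rpower_pos).
  rewrite Rpower_plus, Rpower_1 by lra.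
  assert (P0 := Rpower_pos T eps).
  assert (P1 : 0 <= M ^ (2 * k)) by (apply pow_le; lra).
  assert (P2 : 0 <= Rabs K ^ (2 * k)) by (apply pow_le, Rabs_pos).
  rewrite Rmult_assoc. apply Rmult_le_compat_l; [lra | nra].
Qed.

(** A large value at [tau] persists on an interval of length [tau^-n / (2 E)],
    so it contributes its [2k]-th power, up to a fixed power of [tau], to the
    moment; for [k] large that fixed power is harmless. *)
Lemma pointwise_of_moment_bound (f : C -> C) (sigma eps E tau0 : R) (n : nat) :
  (forall s, Re s = sigma -> 0 < Im s -> exists l, Cderiv f s l) ->
  0 < eps -> 1 <= E ->
  (forall tau t, tau0 <= tau -> tau <= t <= tau + 1 ->
    Cmod (f (sigma, t) - f (sigma, tau)) <= E * tau ^ n * (t - tau)) ->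
  (forall k : nat, (1 <= k)%nat ->
     big_O (fun T => RInt (fun t => Cmod (f (sigma, t)) ^ (2 * k)) 2 T) (fun T => Rpower T (1 + 1))) ->
  big_O (fun t => Cmod (f (sigma, t))) (fun t => Rpower t eps).
Proof.
  intros Hf Heps HE HL Hm.
  (* The power to be absorbed is [tau ^ (n + 2)]: [n] from the length of the interval and 2 from the
     moment bound. So [k] must satisfy [n + 2 <= 2 k eps]. *)
  destruct (nfloor_ex ((INR n + 2) / (2 * eps))) as [k0 [_ Hk0]].
  { apply Rdiv_le_0_compat; [generalize (pos_INR n); lra | lra]. }
  set (k := S k0).
  assert (Hk : INR n + 2 <= eps * INR (2 * k)).
  { apply (Rmult_lt_compat_r (2 * eps)) in Hk0; [| lra].
    replace ((INR n + 2) / (2 * eps) * (2 * eps)) with (INR n + 2) in Hk0 by (field; lra).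
    unfold k. rewrite mult_INR, (S_INR k0). simpl (INR 2). lra. }
  destruct (Hm k ltac:(unfold k; lia)) as [K [T1 HK]].
  (* Here [2 ^ (2 * k)] undoes the halving of [M], and 8 is 2 from the inverse length times 4 from
     [(tau + 1) ^ 2 <= 4 * tau ^ 2]. *)
  set (D0 := 2 ^ (2 * k) * (8 * Rabs K * E)).
  assert (HD0 : 0 <= D0).
  { unfold D0. apply Rmult_le_pos; [apply pow_le; lra |].
    apply Rmult_le_pos; [| lra]. generalize (Rabs_pos K). lra. }
  exists (1 + D0), (Rmax (Rmax T1 tau0) 3). intros tau Htau.
  assert (Htau3 : 3 < tau) by (eapply Rle_lt_trans; [apply Rmax_r | exact Htau]).
  assert (Htau' : Rmax T1 tau0 < tau) by (eapply Rle_lt_trans; [apply Rmax_l | exact Htau]).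
  assert (HtauT : T1 < tau) by (eapply Rle_lt_trans; [apply Rmax_l | exact Htau']).
  assert (Htau0 : tau0 < tau) by (eapply Rle_lt_trans; [apply Rmax_r | exact Htau']).
  rewrite !Rabs_pos_eq by (try apply Cmod_ge_0; left; apply Rpower_pos).
  set (M := Cmod (f (sigma, tau))).
  destruct (Rle_lt_dec M ((1 + D0) * Rpower tau eps)) as [Hle | HM]; [exact Hle | exfalso].
  assert (HX : 1 <= Rpower tau eps) by (apply Rpower_ge_1; lra).
  assert (HM1 : 1 <= M) by nra.
  assert (Htn : 1 <= tau ^ n) by (apply pow_R1_Rle; lra).
  assert (HEt : 1 <= E * tau ^ n) by nra.
  (* Over this length the value changes by at most [1 / 2], which is at most [M / 2] since
     [1 <= M]. *)
  set (len := / (2 * (E * tau ^ n))).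
  assert (Hlen : 0 < len <= 1).
  { unfold len. split; [apply Rinv_0_lt_compat; lra |].
    apply Rle_trans with (/ 1); [apply Rinv_le_contravar; lra | rewrite Rinv_1; lra]. }
  assert (Hlow : forall t, tau <= t <= tau + len -> (M / 2) ^ (2 * k) <= Cmod (f (sigma, t)) ^ (2 * k)).
  { intros t Ht. apply pow_incr. split; [lra |].
    assert (B := HL tau t ltac:(lra) ltac:(lra)).
    assert (B' := Cmod_reverse_triangle (f (sigma, t)) (f (sigma, tau))). fold M in B'.
    apply Rabs_le_between in B'.
    assert (E * tau ^ n * (t - tau) <= E * tau ^ n * len) by (apply Rmult_le_compat_l; lra).
    assert (E * tau ^ n * len = 1 / 2) by (unfold len; field; lra). lra. }
  assert (Hc : forall t, 2 <= t <= tau + 1 -> continuous (fun t => Cmod (f (sigma, t)) ^ (2 * k)) t).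
  { intros t Ht. apply continuous_Cmod_pow_vertical. apply Hf; simpl; lra. }
  assert (HI : len * (M / 2) ^ (2 * k) <= 4 * Rabs K * tau ^ 2).
  { apply Rle_trans with (RInt (fun t => Cmod (f (sigma, t)) ^ (2 * k)) tau (tau + len)).
    - replace (len * (M / 2) ^ (2 * k)) with (RInt (fun _ => (M / 2) ^ (2 * k)) tau (tau + len)).
      2:{ rewrite RInt_const. unfold scal; simpl; unfold mult; simpl. ring. }
      apply RInt_le; [lra | apply ex_RInt_const | |].
      + apply (ex_RInt_continuous (V := R_CompleteNormedModule)).
        rewrite Rmin_left, Rmax_right by lra. intros t Ht. apply Hc. lra.
      + intros t Ht. apply Hlow. lra.
    - eapply Rle_trans.
      { apply (RInt_subinterval_le _ 2 tau (tau + len) (tau + 1)); try lra; [exact Hc |].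
        intros t Ht. apply pow_le, Cmod_ge_0. }
      specialize (HK (tau + 1) ltac:(lra)).
      eapply Rle_trans; [apply Rle_abs |]. eapply Rle_trans; [exact HK |].
      rewrite (Rabs_pos_eq (Rpower _ _)) by (left; apply Rpower_pos).
      rewrite Rpower_plus, Rpower_1 by lra.
      apply Rle_trans with (Rabs K * ((tau + 1) * (tau + 1))).
      + apply Rmult_le_compat_r; [nra | apply Rle_abs].
      + replace (4 * Rabs K * tau ^ 2) with (Rabs K * (4 * tau ^ 2)) by ring.
        apply Rmult_le_compat_l; [apply Rabs_pos | nra]. }
  assert (HMk : M ^ (2 * k) <= D0 * tau ^ (n + 2)).
  { apply (Rmult_le_compat_l (2 ^ (2 * k) * (2 * (E * tau ^ n)))) in HI.
    2:{ apply Rmult_le_pos; [apply pow_le; lra | lra]. }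
    replace (2 ^ (2 * k) * (2 * (E * tau ^ n)) * (len * (M / 2) ^ (2 * k))) with (M ^ (2 * k)) in HI.
    - eapply Rle_trans; [exact HI |]. apply Req_le. unfold D0. rewrite pow_add. ring.
    - transitivity ((2 * (M / 2)) ^ (2 * k)); [f_equal; field |].
      rewrite Rpow_mult_distr. unfold len. field. lra. }
  assert (Htp : tau ^ (n + 2) <= Rpower tau eps ^ (2 * k)).
  { rewrite Rpower_pow_mult, <- Rpower_pow by lra. apply Rpower_exponent_le; [lra |].
    rewrite plus_INR. simpl (INR 2). lra. }
  (* This contradicts [HMk] and [Htp], which bound [M ^ (2 * k)] by only [D0] times the [2k]-th
     power of [Rpower tau eps]. *)
  assert (HDk : 1 + D0 <= (1 + D0) ^ (2 * k)).
  { rewrite <- (pow_1 (1 + D0)) at 1. apply Rle_pow; [lra | unfold k; lia]. }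
  assert (HMD : ((1 + D0) * Rpower tau eps) ^ (2 * k) <= M ^ (2 * k)).
  { apply pow_incr. nra. }
  rewrite Rpow_mult_distr in HMD.
  assert (HX2 : 0 < Rpower tau eps ^ (2 * k)) by (apply pow_lt; lra).
  nra.
Qed.

Lemma barnes_zeta_Cderiv (a : R) (w : list R) (Z : C -> C) (s : C) :
  is_barnes_zeta a w Z -> 0 < Im s -> exists l, Cderiv Z s l.
Proof.
  intros (_ & HZ & _) Hs. apply Cderiv_of_C_differentiable, HZ.
  intros j _ E. rewrite E in Hs. simpl in Hs. lra.
Qed.

(** The difference of [Z] and the constructed continuation vanishes for [Re s > length w] in the
    upper half-plane. The lines wanted lie less than one unit to the left, within reach of
    [vanishing_continuation], which works at heights above 2. *)
Lemma barnes_zeta_lipschitz (a sigma : R) (w : list R) (Z : C -> C) :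
  0 < a -> positive w -> is_barnes_zeta a w Z -> INR (length w) - 1 < sigma ->
  exists (E : R) (n : nat), 1 <= E /\ forall tau t, 3 <= tau -> tau <= t <= tau + 1 ->
    Cmod (Z (sigma, t) - Z (sigma, tau)) <= E * tau ^ n * (t - tau).
Proof.
  intros Ha Hw HZ Hs.
  destruct (barnes_continuation a w Ha Hw) as (F & F1 & HF & HFs).
  destruct (tempered_lipschitz _ sigma F F1 HF Hs) as (E & n & HE & HL).
  exists E, n. split; [exact HE |]. intros tau t Htau Ht.
  assert (HZF : forall u, 2 < u -> Z (sigma, u) = F (sigma, u)).
  { intros u Hu. apply Ceq_minus.
    apply (vanishing_continuation (fun s => Z s - F s)%C (INR (length w) - 1) (INR (length w)));
      try lra.
    - intros s Hs1 Hs2. destruct (barnes_zeta_Cderiv a w Z s HZ Hs2) as [l Hl].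
      eexists. apply Cderiv_minus; [exact Hl | now apply HF].
    - intros s Hs1 Hs2. rewrite (HFs s Hs1 Hs2), (proj1 HZ s Hs1). ring. }
  rewrite !HZF by lra. apply HL; lra.
Qed.

Theorem theorem2p1 :
  forall (r : nat) (a lambda : R) (p : list nat) (zeta : C -> C),
  (1 <= r)%nat ->
  0 < a ->
  0 < lambda ->
  length p = r ->
  (forall q : nat, In q p -> (1 <= q)%nat) ->
  list_gcd p = 1%nat ->
  is_barnes_zeta a (map (fun q : nat => lambda * INR q) p) zeta ->
  ((forall eps sigma : R,
      0 < eps ->
      INR r - 1 / 2 <= sigma <= INR r ->
      big_O (fun t => Cmod (zeta (sigma, t)))
            (fun t => Rpower t eps))
   <->
   (forall (k : nat) (eps sigma : R),
      (1 <= k)%nat ->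
      0 < eps ->
      INR r - 1 / 2 <= sigma <= INR r ->
      big_O (fun T => RInt (fun t => Cmod (zeta (sigma, t)) ^ (2 * k)) 2 T)
            (fun T => Rpower T (1 + eps)))).
Proof.
  intros r a lambda p zeta Hr Ha Hlam Hlen Hp _ Hz.
  assert (Hd : forall sigma s, Re s = sigma -> 0 < Im s -> exists l, Cderiv zeta s l).
  { intros _ s _ Hs. exact (barnes_zeta_Cderiv _ _ zeta s Hz Hs). }
  split.
  - intros H k eps sigma Hk Heps Hsigma.
    apply moment_bound_of_pointwise; try assumption; [apply Hd |].
    apply H; [| exact Hsigma]. apply Rdiv_lt_0_compat; [exact Heps | apply lt_0_INR; lia].
  - intros H eps sigma Heps Hsigma.
    destruct (barnes_zeta_lipschitz a sigma (map (fun q : nat => lambda * INR q) p) zeta Ha) as (E & n & HE & HL).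
    + intros v Hv. apply in_map_iff in Hv. destruct Hv as (q & <- & Hq).
      apply Rmult_lt_0_compat; [exact Hlam |]. apply lt_0_INR. now apply Hp.
    + exact Hz.
    + rewrite length_map, Hlen. lra.
    + apply (pointwise_of_moment_bound zeta sigma eps E 3 n); try assumption; [apply Hd |].
      (* The moments are taken with their own epsilon equal to 1, whatever the pointwise [eps]; only
         the independence of this exponent from [k] matters. *)
      intros k Hk. apply H; [exact Hk | lra | exact Hsigma].
Qed.
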